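(* Let $\mathcal{H}$ be a separable infinite-dimensional real Hilbert space and let $\mathcal{P}$ be the collection of all Borel probability measures on the closed unit ball $\{x\in\mathcal{H}:\|x\|\le 1\}$. For $\mu\in\mathcal{P}$ and an integer $n\ge 3$, let $\mu_n=\frac1n\sum_{i=1}^n\delta_{X_i}$, where $X_1,\dots,X_n$ are i.i.d. random vectors with law $\mu$. Then there are universal constants $c,C>0$ (independent of $n$) such that for every $n\ge 3$, $$\frac{c}{\sqrt{\log n}}\;\le\;\sup_{\mu\in\mathcal{P}}\big(\mathbb{E}\,S_1^2(\mu,\mu_n)\big)^{1/2}\;\le\;\frac{C\sqrt{\log\log n}}{\sqrt{\log n}}.$$
   Context: For probability measures $\mu,\nu$ on a set $E$, $\Pi(\mu,\nu)$ denotes the set of probability measures on $E\times E$ whose first and second marginals are $\mu$ and $\nu$ (couplings). For probability measures $\mu,\nu$ on a separable Hilbert space $\mathcal{H}$ and $1\le k\le\dim\mathcal{H}$, the $k$-dimensional subspace robust 2-Wasserstein distance is $$S_k(\mu,\nu)=\inf_{\pi\in\Pi(\mu,\nu)}\sup_{E\in\mathcal{G}_k}\Big(\int\|P_E(x-y)\|^2\,d\pi(x,y)\Big)^{1/2},$$ where $\mathcal{G}_k$ is the set of $k$-dimensional subspaces of $\mathcal{H}$ and $P_E$ is the orthogonal projection onto $E$. In particular $S_1(\mu,\nu)=\inf_{\pi\in\Pi(\mu,\nu)}\sup_{\|w\|\le1}\big(\int\langle w,x-y\rangle^2\,d\pi(x,y)\big)^{1/2}$. $\log$ denotes the natural logarithm.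 *)

(* Defs.v *)
From HB Require Import structures.
From mathcomp Require Import all_boot all_order all_algebra.
From mathcomp Require Import all_classical all_reals all_analysis.
Set Implicit Arguments. Unset Strict Implicit. Unset Printing Implicit Defensive.
Import Order.TTheory GRing.Theory Num.Theory.
Import numFieldNormedType.Exports.
Local Open Scope classical_set_scope.
Local Open Scope ring_scope.

Section Defs.
Context {R : realType} {H : normedModType R}.

Definition is_inner_product (inner : H -> H -> R) : Prop :=
  (forall x y, inner x y = inner y x) /\
  (forall (a : R) x y z, inner (a *: x + y) z = a * inner x z + inner y z) /\
  (forall x, `|x| ^+ 2 = inner x x).

Definition separable_space : Prop :=
  exists D : set H, countable D /\ closure D = setT.

Definition infinite_dimensional : Prop :=
  forall n : nat, exists v : 'I_n -> H,
    forall a : 'I_n -> R, \sum_(i < n) a i *: v i = 0 -> forall i, a i = 0.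

Definition borelH := g_sigma_algebraType (@open H).
Definition toH (x : borelH) : H := x.

Definition unit_ball : set borelH := [set x | `|toH x| <= 1].

Definition ball_probabilities : set (probability borelH R) :=
  [set mu | mu unit_ball = 1%E].

Definition couplings (mu nu : set borelH -> \bar R)
  : set (probability (borelH * borelH)%type R) :=
  [set pi | forall A : set borelH, measurable A ->
     pi (A `*` setT) = mu A /\ pi (setT `*` A) = nu A].

Definition S1 (inner : H -> H -> R) (mu nu : set borelH -> \bar R) : \bar R :=
  ereal_inf [set ereal_sup
      [set sqrte (\int[pi]_z ((inner w (toH z.1 - toH z.2)) ^+ 2)%:E)%E
        | w in [set w : H | `|w| <= 1]]
    | pi in couplings mu nu].

Definition empirical (n : nat) (x : 'I_n -> borelH) : set borelH -> \bar R :=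
  fun A => ((n%:R^-1)%:E * \sum_(i < n) \d_(x i) A)%E.

Definition iid_with_law {d} {Omega : measurableType d} (P : probability Omega R)
  (n : nat) (mu : set borelH -> \bar R) (X : 'I_n -> Omega -> borelH) : Prop :=
  (forall i, measurable_fun setT (X i)) /\
  forall A : 'I_n -> set borelH, (forall i, measurable (A i)) ->
    P (\bigcap_(i in [set: 'I_n]) (X i @^-1` A i)) = (\prod_(i < n) mu (A i))%E.

Definition sup_rms_S1 (inner : H -> H -> R) (n : nat) : \bar R :=
  ereal_sup [set v | exists (mu : probability borelH R) (d : measure_display)
      (Omega : measurableType d) (P : probability Omega R)
      (X : 'I_n -> Omega -> borelH),
      ball_probabilities mu /\ iid_with_law P mu X /\
      v = sqrte (\int[P]_w (S1 inner mu (empirical (fun i => X i w))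
                           * S1 inner mu (empirical (fun i => X i w))))%E].

End Defs.

(* Main.v *)
(** Upper bound. Fix [d] of order [ln n / ln (ln n)].  At most [d] orthonormal
    directions carry second moment above [1/d] (Bessel), so after projecting
    them out every unit direction has second moment at most [1/d].  In these
    directions a grid of mesh [1/d] has about [(2d+1)^d <= n] cells; coupling
    [mu] and [mu_n] inside the cells as much as possible, the cost is [O(1/d)]
    plus (i) the total variation distance between the cell masses and (ii) the
    operator norm of the difference between the covariances of [mu] and
    [mu_n].  Both have the form [sum_ab s_a s_b K(a,b)] with [s] the empirical
    error, and such an expression has mean at most [1/n] if [K >= 0] and
    [K(a,a) <= 1]; for (ii), [K(a,b) = <v_a,v_b>^2], and the operator norm is
    at most the Hilbert-Schmidt norm.  A preliminary discretisation of [mu]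
    reduces all of this to finite sums.

    Lower bound. Let [mu] be uniform on the vertices of a cube of dimension
    [m] of order [ln n], scaled into the unit ball.  Counting Hamming balls,
    [n] points leave half of the vertices at distance of order 1, so every
    coupling has total displacement of order 1, hence some direction carries
    at least a constant times [1/m]. *)
Require Import Defs.
From HB Require Import structures.
From mathcomp Require Import all_boot all_order all_algebra.
From mathcomp Require Import all_classical all_reals all_analysis.
From mathcomp Require Import measurable_realfun.
From mathcomp Require Import ring lra.
Import Order.TTheory GRing.Theory Num.Theory.
Import numFieldNormedType.Exports.
Local Open Scope classical_set_scope.
Local Open Scope ring_scope.

(** * Inner products and squared Gram forms *)

Section InnerProduct.
Context {R : realType} {H : normedModType R} {ip : H -> H -> R}.
Context (hip : is_inner_product ip).

Lemma ipC x y : ip x y = ip y x.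
Proof. by case: hip. Qed.

Lemma ip_norm x : ip x x = `|x| ^+ 2.
Proof. by case: hip => _ [_ ->]. Qed.

Lemma ipDZl a x y z : ip (a *: x + y) z = a * ip x z + ip y z.
Proof. by case: hip => _ [-> _]. Qed.

Lemma ipDl x y z : ip (x + y) z = ip x z + ip y z.
Proof. by rewrite -[x]scale1r ipDZl mul1r scale1r. Qed.

Lemma ip0l z : ip 0 z = 0.
Proof. by apply: (addrI (ip 0 z)); rewrite -ipDl !addr0. Qed.

Lemma ipZl a x z : ip (a *: x) z = a * ip x z.
Proof. by rewrite -[a *: x]addr0 ipDZl ip0l addr0. Qed.

Lemma ipBl x y z : ip (x - y) z = ip x z - ip y z.
Proof. by rewrite -scaleN1r ipDl ipZl mulN1r. Qed.

Lemma ip0r z : ip z 0 = 0.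
Proof. by rewrite ipC ip0l. Qed.

Lemma ipZr a x z : ip z (a *: x) = a * ip z x.
Proof. by rewrite ipC ipZl !(ipC z). Qed.

Lemma ipBr x y z : ip z (x - y) = ip z x - ip z y.
Proof. by rewrite ipC ipBl !(ipC z). Qed.

Lemma ip_suml (I : finType) (F : I -> H) z :
  ip (\sum_i F i) z = \sum_i ip (F i) z.
Proof.
by apply: (big_morph (ip^~ z) _ (ip0l z)) => x y; exact: ipDl.
Qed.

Lemma ip_sumr (I : finType) (F : I -> H) z :
  ip z (\sum_i F i) = \sum_i ip z (F i).
Proof. by rewrite ipC ip_suml; apply: eq_bigr => i _; exact: ipC. Qed.

Lemma cauchy_schwarz x y : ip x y ^+ 2 <= `|x| ^+ 2 * `|y| ^+ 2.
Proof.
have [->|y0] := eqVneq y 0; first by rewrite ip0r expr0n/= mulr_ge0 ?sqr_ge0.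
have yy : 0 < `|y| ^+ 2 by rewrite exprn_gt0// normr_gt0.
have := sqr_ge0 `|(`|y| ^+ 2) *: x - ip x y *: y|.
rewrite -(ip_norm (_ - _)) !(ipBl, ipBr, ipZl, ipZr) !ip_norm (ipC y x) => h.
rewrite -subr_ge0 -(pmulr_rge0 _ yy); apply: le_trans h _.
by rewrite le_eqVlt; apply/orP; left; apply/eqP; ring.
Qed.

Lemma ip_abs_le x y : `|ip x y| <= `|x| * `|y|.
Proof.
rewrite -(@ler_pXn2r _ 2) ?nnegrE ?mulr_ge0// exprMn real_normK ?num_real//.
exact: cauchy_schwarz.
Qed.

Definition orthonormal_family {m} (e : 'I_m -> H) :=
  forall i j, ip (e i) (e j) = (i == j)%:R.

Definition orth_part {m} (e : 'I_m -> H) w := w - \sum_i ip w (e i) *: e i.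

Section Orthonormal.
Context {m : nat} {e : 'I_m -> H} (he : orthonormal_family e).

Lemma ip_orth_sum (c : 'I_m -> R) j : ip (\sum_i c i *: e i) (e j) = c j.
Proof.
rewrite ip_suml (bigD1 j)//= ipZl he eqxx mulr1 big1 ?addr0// => i ij.
by rewrite ipZl he (negbTE ij) mulr0.
Qed.

Lemma ip_orth_part w j : ip (orth_part e w) (e j) = 0.
Proof. by rewrite ipBl ip_orth_sum subrr. Qed.

Lemma norm_orth_part w :
  `|orth_part e w| ^+ 2 = `|w| ^+ 2 - \sum_i ip w (e i) ^+ 2.
Proof.
rewrite -ip_norm {2}/orth_part ipBr ip_sumr big1 ?subr0; last first.
  by move=> i _; rewrite ipZr ip_orth_part mulr0.
rewrite ipBl ip_norm ip_suml; congr (_ - _).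
by apply: eq_bigr => i _; rewrite ipZl (ipC (e i)).
Qed.

Lemma bessel w : \sum_i ip w (e i) ^+ 2 <= `|w| ^+ 2.
Proof. by rewrite -subr_ge0 -norm_orth_part sqr_ge0. Qed.

Lemma norm_orth_part_le w : `|orth_part e w| <= `|w|.
Proof.
rewrite -(@ler_pXn2r _ 2) ?nnegrE// norm_orth_part gerBl.
by apply: sumr_ge0 => i _; exact: sqr_ge0.
Qed.

Lemma orthonormal_ext u : `|u| = 1 -> (forall i, ip u (e i) = 0) ->
  orthonormal_family (fun i : 'I_m.+1 => oapp e u (unlift ord_max i)).
Proof.
move=> u1 ue i j.
case: (unliftP ord_max i) => [i' ->|->]; case: (unliftP ord_max j) => [j' ->|->].
- by rewrite /= he (inj_eq lift_inj).
- by rewrite /= ipC ue eq_sym (negbTE (neq_lift _ _)).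
- by rewrite /= ue (negbTE (neq_lift _ _)).
- by rewrite /= ip_norm u1 expr1n eqxx.
Qed.

End Orthonormal.

Lemma unit_scale (w : H) : w != 0 -> `|(`|w|^-1) *: w| = 1.
Proof.
move=> w0; rewrite normrZ normfV normr_id mulVf//.
by rewrite normr_eq0.
Qed.

(* A unit direction orthogonal to [e] along which the second moment exceeds
   [1/d] can be adjoined; by Bessel this happens at most [d] times. *)
Lemma greedy_subspace (T : finType) (p : T -> R) (v : T -> H) d :
  (0 < d)%N -> (forall a, 0 <= p a) -> \sum_a p a = 1 ->
  (forall a, `|v a| <= 1) ->
  exists m (e : 'I_m -> H), [/\ (m <= d)%N, orthonormal_family e &
    forall w, (forall i, ip w (e i) = 0) ->
      \sum_a p a * ip w (v a) ^+ 2 <= `|w| ^+ 2 / d%:R].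
Proof.
move=> d0 p0 p1 v1; apply: contrapT => no.
have [e he hbig] : exists2 e : 'I_d -> H, orthonormal_family e &
    forall i, d%:R^-1 < \sum_a p a * ip (e i) (v a) ^+ 2.
  suff /(_ d (leqnn d))[e [he hb]] : forall k, (k <= d)%N ->
      exists e : 'I_k -> H, orthonormal_family e /\
      forall i, d%:R^-1 < \sum_a p a * ip (e i) (v a) ^+ 2 by exists e.
  elim=> [|k IH] kd.
    by exists (fun _ => 0); split; [case|case].
  have [e [he hb]] := IH (ltnW kd).
  have [w [we wbig]] : exists w, (forall i, ip w (e i) = 0) /\
      `|w| ^+ 2 / d%:R < \sum_a p a * ip w (v a) ^+ 2.
    apply: contrapT => now; apply: no; exists k, e; split => //; first exact: ltnW.
    move=> w we; rewrite leNgt; apply/negP => wb; apply: now; by exists w.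
  have w0 : w != 0.
    apply/negP => /eqP w0; move: wbig; rewrite w0 normr0 expr0n/= mul0r big1 ?ltxx//.
    by move=> a _; rewrite ip0l expr0n/= mulr0.
  exists (fun i => oapp e (`|w|^-1 *: w) (unlift ord_max i)); split.
    apply: orthonormal_ext => //; first exact: unit_scale.
    by move=> i; rewrite ipZl we mulr0.
  move=> i; case: (unliftP ord_max i) => [j _|_] /=; first exact: hb.
  have w2 : 0 < `|w| ^+ 2 by rewrite exprn_gt0// normr_gt0.
  have -> : \sum_a p a * ip (`|w|^-1 *: w) (v a) ^+ 2 =
            (\sum_a p a * ip w (v a) ^+ 2) / `|w| ^+ 2.
    rewrite mulr_suml; apply: eq_bigr => a _.
    by rewrite ipZl exprMn exprVn; ring.
  by rewrite ltr_pdivlMr// mulrC.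
(* The [d] directions would carry total second moment above 1, whereas Bessel allows at most
   [|v a| ^ 2 <= 1] at each atom; [0 < d] makes the sum strict. *)
have : 1 < \sum_(i < d) \sum_a p a * ip (e i) (v a) ^+ 2.
  apply: (@le_lt_trans _ _ (\sum_(i < d) d%:R^-1)).
    by rewrite sumr_const card_ord -(mulr_natr _^-1) mulVf// pnatr_eq0 -lt0n.
  apply: ltr_sum => //; apply/hasP; exists (Ordinal d0) => //.
apply/negP; rewrite -leNgt exchange_big/= -p1; apply: ler_sum => a _.
rewrite -mulr_sumr ler_piMr//.
rewrite (eq_bigr (fun i => ip (v a) (e i) ^+ 2)); last by move=> i _; rewrite ipC.
apply: (le_trans (bessel he _)); by rewrite expr_le1.
Qed.

Section SquaredGram.
Context {T : finType}.
Implicit Types (s : T -> R) (v : T -> H).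

Definition quad s (K : T -> T -> R) := \sum_a \sum_b s a * s b * K a b.

Definition orth_to (u x : H) := x - ip x u *: u.

(** [ip (v a) (v b)] is the product of the [u]-components plus the inner product of the remainders;
    squaring it gives three terms that sum separately. The form is the squared Hilbert-Schmidt norm
    of [\sum_a s a * <v a, .> v a]. *)
Lemma quad_gram_split s v u : `|u| = 1 ->
  quad s (fun a b => ip (v a) (v b) ^+ 2) =
    (\sum_a s a * ip u (v a) ^+ 2) ^+ 2
    + 2 * `|\sum_a (s a * ip u (v a)) *: orth_to u (v a)| ^+ 2
    + quad s (fun a b => ip (orth_to u (v a)) (orth_to u (v b)) ^+ 2).
Proof.
move=> u1; rewrite [(\sum_a s a * ip u (v a) ^+ 2) ^+ 2]expr2.
rewrite -(ip_norm (\sum_a _ *: _)) ip_suml mulr_suml mulr_sumr /quad -!big_split/=.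
apply: eq_bigr => a _.
rewrite ip_sumr !mulr_sumr -!big_split/=; apply: eq_bigr => b _.
have -> : ip (v a) (v b) = ip u (v a) * ip u (v b)
   + ip (orth_to u (v a)) (orth_to u (v b)).
  rewrite /orth_to !(ipBl, ipBr, ipZl, ipZr) ip_norm u1 !(ipC _ u).
  by ring.
by rewrite ipZl ipZr; ring.
Qed.

(** Induction on the number of nonzero vectors: splitting off the direction of a nonzero [v a] kills
    [v a] and keeps zero vectors zero, and the terms split off are squares. *)
Lemma quad_gram_ge0 s v : 0 <= quad s (fun a b => ip (v a) (v b) ^+ 2).
Proof.
have [k] := ubnP #|[pred a | v a != 0]|; elim: k v => // k IH v vk.
have [v0|/existsNP[a /eqP va]] := pselect (forall a, v a = 0).
  rewrite /quad big1// => a _; rewrite big1// => b _.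
  by rewrite v0 ip0l expr0n/= mulr0.
pose u := `|v a|^-1 *: v a; have u1 : `|u| = 1 by exact: unit_scale.
rewrite (quad_gram_split _ _ _ u1) !addr_ge0 ?sqr_ge0 ?mulr_ge0 ?sqr_ge0//.
apply: IH; rewrite -ltnS; apply: leq_trans vk; rewrite ltnS.
apply: proper_card; apply/properP; split.
  apply/fintype.subsetP => b; rewrite !inE; apply: contra => /eqP ->.
  by rewrite /orth_to ip0l scale0r subrr.
exists a; rewrite inE// negbK /orth_to /u ipZr ip_norm scalerA.
rewrite expr2 mulKf ?normr_eq0// mulfV ?normr_eq0// scale1r subrr eqxx//.
Qed.

(** The operator norm is at most the Hilbert-Schmidt norm: with [u = w / |w|], the left side is
    [|w| ^ 4] times the first term of [quad_gram_split], whose other terms are nonnegative. *)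
Lemma sqr_quad_form_le s v w : `|w| <= 1 ->
  (\sum_a s a * ip w (v a) ^+ 2) ^+ 2 <=
    quad s (fun a b => ip (v a) (v b) ^+ 2).
Proof.
move=> w1; have [->|w0] := eqVneq w 0.
  rewrite big1 ?expr0n/= ?quad_gram_ge0// => a _.
  by rewrite ip0l expr0n/= mulr0.
have u1 := unit_scale _ w0; set u := _ *: w in u1.
have wu : w = `|w| *: u by rewrite scalerA mulfV ?normr_eq0// scale1r.
rewrite (quad_gram_split s v _ u1) -addrA ler_wpDr//.
  by rewrite addr_ge0 ?quad_gram_ge0// mulr_ge0 ?sqr_ge0.
rewrite [X in X ^+ 2 <= _](_ : _ = `|w| ^+ 2 * \sum_a s a * ip u (v a) ^+ 2).
  rewrite exprMn ler_piMl ?sqr_ge0// -exprM expr_le1//.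
rewrite mulr_sumr; apply: eq_bigr => a _; rewrite {1}wu ipZl; ring.
Qed.

End SquaredGram.
End InnerProduct.

Arguments orthonormal_family {R H} ip {m} e.
Arguments orth_part {R H} ip {m} e w.

(** * Couplings of finite distributions *)

Section FiniteCoupling.
Context {R : realType}.

(* The common mass [min m h] stays in place and the excess of [m] is spread
   proportionally over the deficit; everything is written as a density with
   respect to the product weight, with the convention x/0 = 0. *)
Lemma label_coupling (L : finType) (m h : L -> R) :
  (forall c, 0 <= m c) -> (forall c, 0 <= h c) -> \sum_c m c = \sum_c h c ->
  exists rho : L -> L -> R, [/\ forall c c', 0 <= rho c c',
    forall c, m c != 0 -> \sum_c' h c' * rho c c' = 1,
    forall c', h c' != 0 -> \sum_c m c * rho c c' = 1 &
    \sum_c \sum_c' m c * h c' * (rho c c' * (c != c')%:R)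
      <= \sum_c `|m c - h c|].
Proof.
move=> m0 h0 mh.
pose mn c := Num.min (m c) (h c).
pose P c := m c - mn c; pose N c := h c - mn c; pose D := \sum_c P c.
have mn0 c : 0 <= mn c by rewrite /mn le_min m0 h0.
have P0 c : 0 <= P c by rewrite subr_ge0 /mn ge_min lexx.
have N0 c : 0 <= N c by rewrite subr_ge0 /mn ge_min lexx orbT.
have D0 : 0 <= D by apply: sumr_ge0.
have DN : D = \sum_c N c by rewrite /D /P /N !big_split/= mh.
have Pm c : m c = 0 -> P c = 0.
  by move=> mc; apply/eqP; rewrite eq_le P0 andbT /P mc sub0r oppr_le0 mn0.
have Nh c : h c = 0 -> N c = 0.
  by move=> hc; apply/eqP; rewrite eq_le N0 andbT /N hc sub0r oppr_le0 mn0.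
have mnm c : m c = 0 -> mn c = 0.
  by move=> mc; apply/eqP; rewrite eq_le mn0 andbT /mn ge_min mc lexx.
have mnh c : h c = 0 -> mn c = 0.
  by move=> hc; apply/eqP; rewrite eq_le mn0 andbT /mn ge_min hc lexx orbT.
have canc (x y : R) : (x = 0 -> y = 0) -> x * (y / x) = y.
  move=> xy; have [x0|x0] := eqVneq x 0; first by rewrite xy// x0 mul0r.
  by rewrite mulrC divfK.
(* When [D = 0] the factor [D / D] is 0, but then every excess is 0 too, so a single formula for
   [rho] covers both cases. *)
have DP c : P c * (D / D) = P c.
  have [d0|d0] := eqVneq D 0; last by rewrite divff// mulr1.
  have : P c <= D by rewrite /D (bigD1 c)//= lerDl; exact: sumr_ge0.
  by rewrite d0 => Pc0; have -> : P c = 0 by [apply/eqP; rewrite eq_le Pc0 P0]; rewrite mul0r.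
have DN' c : N c * (D / D) = N c.
  have [d0|d0] := eqVneq D 0; last by rewrite divff// mulr1.
  have : N c <= D by rewrite DN (bigD1 c)//= lerDl; exact: sumr_ge0.
  by rewrite d0 => Pc0; have -> : N c = 0 by [apply/eqP; rewrite eq_le Pc0 N0]; rewrite mul0r.
(* The kept mass [mn c] on the diagonal, divided by both weights, plus the product of excess and
   deficit, normalised by their common total [D]. *)
pose rho c c' := (c == c')%:R * (mn c / m c / h c) + (P c / m c) * (N c' / h c') / D.
exists rho; split.
- move=> c c'; rewrite addr_ge0 ?mulr_ge0 ?invr_ge0//.
- move=> c mc.
  have -> : \sum_c' h c' * rho c c' =
      h c * (mn c / h c) / m c + (\sum_c' h c' * (N c' / h c')) * (P c / m c / D).
    rewrite [RHS]addrC mulr_suml /rho (bigD1 c)//= [in RHS](bigD1 c)//= eqxx /=.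
    rewrite (eq_bigr (fun i => h i * (N i / h i) * (P c / m c / D))); first by ring.
    by move=> i ic; rewrite eq_sym (negbTE ic) /=; ring.
  rewrite canc; last exact: mnh.
  rewrite (eq_bigr N) -?DN; last by move=> i _; rewrite canc//; exact: Nh.
  have -> : mn c / m c + D * (P c / m c / D) = (mn c + P c * (D / D)) / m c by ring.
  by rewrite DP /P addrC subrK divff.
- move=> c hc.
  have -> : \sum_c' m c' * rho c' c =
      m c * (mn c / m c) / h c + (\sum_c' m c' * (P c' / m c')) * (N c / h c / D).
    rewrite [RHS]addrC mulr_suml /rho (bigD1 c)//= [in RHS](bigD1 c)//= eqxx /=.
    rewrite (eq_bigr (fun i => m i * (P i / m i) * (N c / h c / D))); first by ring.
    by move=> i ic; rewrite (negbTE ic) /=; ring.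
  rewrite canc; last exact: mnm.
  rewrite (eq_bigr P) -/D; last by move=> i _; rewrite canc//; exact: Pm.
  have -> : mn c / h c + D * (N c / h c / D) = (mn c + N c * (D / D)) / h c by ring.
  by rewrite DN' /N addrC subrK divff.
(* Off the diagonal only the second summand of [rho] survives; its total mass is at most [D], the
   sum of the positive parts of [m - h]. *)
- apply: (@le_trans _ _ D); last first.
    apply: ler_sum => c _; rewrite /P /mn.
    case: (leP (m c) (h c)) => _; first by rewrite subrr.
    exact: ler_norm.
  apply: (@le_trans _ _ (\sum_c \sum_c' P c * (N c' / D))).
    apply: ler_sum => c _; apply: ler_sum => c' _; rewrite /rho.
    have [_|_] := eqVneq c c'; rewrite /= ?mulr0 ?mulr1; first by rewrite mulr_ge0 ?divr_ge0.
    rewrite mul0r add0r.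
    have -> : m c * h c' * (P c / m c * (N c' / h c') / D) =
      (m c * (P c / m c)) * (h c' * (N c' / h c')) / D by ring.
    by rewrite !canc ?mulrA//; [exact: Nh|exact: Pm].
  rewrite [leLHS](_ : _ = D)//.
  under eq_bigr do rewrite -mulr_sumr -mulr_suml -DN DP.
  by [].
Qed.

(** Couple the cell masses by [label_coupling] and let the density depend on the cells alone: sums
    weighted by [p] or [q] collapse to sums over cells, and points of nonzero weight lie in cells of
    nonzero mass. *)
Lemma cell_coupling (T L : finType) (k : T -> L) (p q : T -> R) :
  (forall a, 0 <= p a) -> (forall a, 0 <= q a) ->
  \sum_a p a = 1 -> \sum_a q a = 1 ->
  exists rho : T -> T -> R, [/\ forall a b, 0 <= rho a b,
    forall a, p a != 0 -> \sum_b q b * rho a b = 1,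
    forall b, q b != 0 -> \sum_a p a * rho a b = 1 &
    \sum_a \sum_b p a * q b * (rho a b * (k a != k b)%:R)
      <= \sum_c `|\sum_(a | k a == c) (q a - p a)| ].
Proof.
move=> p0 q0 p1 q1.
pose mass (r : T -> R) c := \sum_(a | k a == c) r a.
have massE (r : T -> R) (f : L -> R) : \sum_a r a * f (k a) = \sum_c mass r c * f c.
  rewrite (partition_big k xpredT)//=; apply: eq_bigr => c _.
  by rewrite /mass mulr_suml; apply: eq_bigr => a /eqP ->.
have mass0 r c : (forall a, 0 <= r a) -> 0 <= mass r c by move=> r0; exact: sumr_ge0.
have massT r : \sum_c mass r c = \sum_a r a.
  by rewrite [RHS](partition_big k xpredT).
have massN r a : (forall a, 0 <= r a) -> r a != 0 -> mass r (k a) != 0.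
  move=> r0; apply: contra => /eqP h; rewrite eq_le r0 andbT -h.
  by rewrite /mass (bigD1 a)//= lerDl; exact: sumr_ge0.
have [rho [rho0 row col mis]] := label_coupling L (mass p) (mass q)
  (mass0 p ^~ p0) (mass0 q ^~ q0) (etrans (etrans (massT p) p1) (esym (etrans (massT q) q1))).
exists (fun a b => rho (k a) (k b)); split => //.
- by move=> a pa; rewrite (massE q) row// massN.
- by move=> b qb; rewrite (massE p (fun c => rho c (k b))) col// massN.
- apply: le_trans (le_trans mis _); last first.
    apply: ler_sum => c _; rewrite distrC /mass -sumrB//.
  rewrite le_eqVlt; apply/orP; left; apply/eqP.
  transitivity (\sum_a p a * \sum_c' mass q c' * (rho (k a) c' * (k a != c')%:R)).
    apply: eq_bigr => a _; rewrite -(massE q (fun c' => rho (k a) c' * (k a != c')%:R)) mulr_sumr.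
    by apply: eq_bigr => b _; rewrite -mulrA.
  apply: etrans (massE p (fun c => \sum_c' mass q c' * (rho c c' * (c != c')%:R))) _.
  by apply: eq_bigr => c _; rewrite mulr_sumr; apply: eq_bigr => c' _; rewrite -mulrA.
Qed.

(** * Moments of the empirical frequencies *)

Section Multinomial.
Context {T : finType} {p : T -> R} (p1 : \sum_a p a = 1).
Context {n : nat} (n0 : (0 < n)%N).

Definition sample_prob (t : {ffun 'I_n -> T}) := \prod_i p (t i).
Definition freq (t : {ffun 'I_n -> T}) a : R := n%:R^-1 * \sum_i (t i == a)%:R.

Lemma sample_mean1 (g : T -> R) i :
  \sum_t sample_prob t * g (t i) = \sum_x p x * g x.
Proof.
transitivity (\prod_(l < n) \sum_x p x * (if l == i then g x else 1)).
  rewrite bigA_distr_bigA/=; apply: eq_bigr => t _.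
  rewrite big_split/=; congr (_ * _).
  by rewrite (bigD1 i)//= eqxx big1 ?mulr1// => l /negbTE ->.
rewrite (bigD1 i)//= eqxx [X in _ * X]big1 ?mulr1// => l /negbTE ->.
by under eq_bigr do rewrite mulr1.
Qed.

Lemma sample_mean2 (g h : T -> R) i j : i != j ->
  \sum_t sample_prob t * (g (t i) * h (t j)) =
    (\sum_x p x * g x) * (\sum_x p x * h x).
Proof.
move=> ij; have ji : j != i by rewrite eq_sym.
transitivity (\prod_(l < n) \sum_x
    p x * (if l == i then g x else if l == j then h x else 1)).
  rewrite bigA_distr_bigA/=; apply: eq_bigr => t _.
  rewrite big_split/=; congr (_ * _).
  rewrite (bigD1 i)//= eqxx (bigD1 j)//= (negbTE ji) eqxx.
  by rewrite big1 ?mulr1// => l /andP[/negbTE -> /negbTE ->].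
rewrite (bigD1 i)//= eqxx (bigD1 j)//= (negbTE ji) eqxx.
rewrite [X in _ * (_ * X)]big1 ?mulr1// => l /andP[/negbTE -> /negbTE ->].
by under eq_bigr do rewrite mulr1.
Qed.

Lemma sample_mean_cst c : \sum_t sample_prob t * c = c.
Proof.
by rewrite (sample_mean1 (fun=> c) (Ordinal n0)) -mulr_suml p1 mul1r.
Qed.

Lemma sum_pred1 (f : T -> R) a : \sum_x f x * (x == a)%:R = f a.
Proof.
rewrite (bigD1 a)//= eqxx mulr1 big1 ?addr0// => x /negbTE ->.
by rewrite mulr0.
Qed.

(** Multinomial covariance. Each frequency error is a mean of centred indicators; pairs of distinct
    draws contribute 0 by independence, and the [n] diagonal pairs leave one factor [1 / n]. *)
Lemma freq_cov a b :
  \sum_t sample_prob t * ((freq t a - p a) * (freq t b - p b)) =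
    n%:R^-1 * ((a == b)%:R * p a - p a * p b).
Proof.
have n1 : n%:R != 0 :> R by rewrite pnatr_eq0 -lt0n.
have fE t c : freq t c - p c = n%:R^-1 * \sum_(i < n) ((t i == c)%:R - p c).
  rewrite sumrB sumr_const card_ord -[p c *+ n]mulr_natl mulrBr mulrA mulVf//.
  by rewrite mul1r.
have mean0 c : \sum_x p x * ((x == c)%:R - p c) = 0.
  under eq_bigr do rewrite mulrBr.
  by rewrite sumrB sum_pred1 -mulr_suml p1 mul1r subrr.
transitivity (n%:R^-1 * (n%:R^-1 * \sum_(i < n) \sum_(j < n) \sum_t
   sample_prob t * (((t i == a)%:R - p a) * ((t j == b)%:R - p b)))).
  transitivity (\sum_t n%:R^-1 * (n%:R^-1 * \sum_(i < n) \sum_(j < n)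
     sample_prob t * (((t i == a)%:R - p a) * ((t j == b)%:R - p b)))); last first.
    rewrite -!mulr_sumr; congr (_ * (_ * _)); rewrite exchange_big/=.
    by apply: eq_bigr => i _; rewrite exchange_big.
  apply: eq_bigr => t _; rewrite !fE.
  set S := \sum_(i < n) \sum_(j < n) _.
  have -> : S = sample_prob t * ((\sum_(i < n) ((t i == a)%:R - p a)) *
      (\sum_(j < n) ((t j == b)%:R - p b))).
    rewrite mulr_suml mulr_sumr; apply: eq_bigr => i _.
    by rewrite mulr_sumr mulr_sumr.
  by ring.
rewrite (eq_bigr (fun=> (a == b)%:R * p a - p a * p b)); last first.
  move=> i _; rewrite (bigD1 i)//= [X in _ + X]big1 ?addr0; last first.
    move=> j ji; apply: etrans (sample_mean2 (fun x => (x == a)%:R - p a)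
       (fun x => (x == b)%:R - p b) i j _) _; first by rewrite eq_sym.
    by rewrite mean0 mul0r.
  apply: etrans (sample_mean1 (fun x => ((x == a)%:R - p a) * ((x == b)%:R - p b)) i) _.
  transitivity (\sum_x ((p x * (x == b)%:R) * (x == a)%:R
      - p b * (p x * (x == a)%:R) - p a * (p x * ((x == b)%:R - p b)))).
    by apply: eq_bigr => x _; ring.
  rewrite !sumrB -!mulr_sumr mean0 !sum_pred1.
  by rewrite mulr0 subr0 mulrC (mulrC (p b)).
rewrite sumr_const card_ord -[X in _ * (_ * X)]mulr_natl.
by rewrite [X in _ * X]mulrA mulVf// mul1r.
Qed.

(** By [freq_cov] the mean is [1 / n] times [\sum_a p a * K a a], which is at most 1, minus a double
    sum that is nonnegative because [K >= 0]. *)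
Lemma mean_quad_freq_le (K : T -> T -> R) : (forall a, 0 <= p a) ->
  (forall a b, 0 <= K a b) -> (forall a, K a a <= 1) ->
  \sum_t sample_prob t * quad (fun a => freq t a - p a) K <= n%:R^-1.
Proof.
move=> p0 K0 K1.
have -> : \sum_t sample_prob t * quad (fun a => freq t a - p a) K =
    n%:R^-1 * \sum_a \sum_b ((a == b)%:R * p a - p a * p b) * K a b.
  transitivity (\sum_a \sum_b \sum_t
      sample_prob t * ((freq t a - p a) * (freq t b - p b)) * K a b); last first.
    rewrite mulr_sumr; apply: eq_bigr => a _; rewrite mulr_sumr.
    by apply: eq_bigr => b _; rewrite -mulr_suml freq_cov mulrA.
  rewrite [RHS](eq_bigr (fun a => \sum_t \sum_b
      sample_prob t * ((freq t a - p a) * (freq t b - p b)) * K a b)); last first.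
    by move=> a _; rewrite exchange_big.
  rewrite [RHS]exchange_big/=; apply: eq_bigr => t _.
  rewrite /quad mulr_sumr; apply: eq_bigr => a _; rewrite mulr_sumr.
  by apply: eq_bigr => b _; rewrite !mulrA.
rewrite ler_piMr ?invr_ge0// -[leRHS]p1; apply: ler_sum => a _.
rewrite (bigD1 a)//= eqxx mul1r; apply: (@le_trans _ _ (p a * K a a)).
  rewrite mulrBl -addrA gerDl addrC subr_le0.
  apply: (@le_trans _ _ 0); last by rewrite !mulr_ge0.
  apply: sumr_le0 => b ba; rewrite eq_sym (negbTE ba) mul0r sub0r mulNr oppr_le0.
  by rewrite !mulr_ge0.
by rewrite ler_piMr.
Qed.

End Multinomial.
End FiniteCoupling.

Arguments sample_prob {R T} p {n} t.

(** * The discrete coupling *)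

Section DiscreteCoupling.
Context {R : realType} {H : normedModType R} {ip : H -> H -> R}.
Context (hip : is_inner_product ip).

(** Round [d * (f + 1)], which lies in [[0, 2 d]], down to an integer; the endpoint [2 d] may be
    attained, whence [2 d + 1] values per coordinate. *)
Lemma grid_cells (T : finType) m (f : 'I_m -> T -> R) d : (0 < d)%N ->
  (forall j a, `|f j a| <= 1) ->
  exists k : T -> {ffun 'I_m -> 'I_(2 * d).+1},
    forall a b, k a = k b -> forall j, `|f j a - f j b| <= d%:R^-1.
Proof.
move=> d0 f1; have dp : 0 < d%:R :> R by rewrite ltr0n.
pose g j a := d%:R * (f j a + 1).
have g0 j a : 0 <= g j a.
  by rewrite mulr_ge0 ?(ltW dp)//; move: (f1 j a); rewrite ler_norml; lra.
have gt j a : (Num.truncn (g j a) < (2 * d).+1)%N.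
  rewrite ltnS truncn_le_nat; apply: (@le_lt_trans _ _ (2 * d)%:R); last first.
    by rewrite ltr_nat.
  rewrite natrM [2%:R * _]mulrC ler_wpM2l ?(ltW dp)//.
  by move: (f1 j a); rewrite ler_norml; lra.
exists (fun a => [ffun j => inord (Num.truncn (g j a))]) => a b kab j.
have : Num.truncn (g j a) = Num.truncn (g j b).
  by move/ffunP/(_ j): kab; rewrite !ffunE => /(congr1 val); rewrite /= !inordK.
move: (truncn_itv (g0 j a)) (truncn_itv (g0 j b)) => + + E.
rewrite E -natr1; set z := _%:R => /andP[h1 h2] /andP[h3 h4].
rewrite -(ler_pM2l dp) mulfV ?gt_eqF// -{1}(ger0_norm (ltW dp)) -normrM.
have -> : d%:R * (f j a - f j b) = g j a - g j b by rewrite /g; ring.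
by rewrite ler_norml; lra.
Qed.

Section Cost.
Context {T : finType} {v : T -> H} (v1 : forall a, `|v a| <= 1).
Context {m : nat} {e : 'I_m -> H} (he : orthonormal_family ip e).
Context {d : nat} (d0 : (0 < d)%N) (md : (m <= d)%N).
Context {L : finType} {k : T -> L}.
Context (hk : forall a b, k a = k b ->
  forall j, `|ip (e j) (v a) - ip (e j) (v b)| <= d%:R^-1).

(** Split [x = v a - v b] into its projection [px] on the span of [e] and the rest, which [w] sees
    only through [w']. In a common cell [|px| ^ 2 <= m / d ^ 2 <= 1 / d]; otherwise
    [|px| ^ 2 <= |x| ^ 2 <= 4]. *)
Lemma sqr_ip_diff_le w a b : `|w| <= 1 ->
  ip w (v a - v b) ^+ 2 <= 3 * (ip (orth_part ip e w) (v a) ^+ 2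
     + ip (orth_part ip e w) (v b) ^+ 2 + (d%:R^-1 + 4 * (k a != k b)%:R)).
Proof.
move=> w1.
have dp : 0 < d%:R :> R by rewrite ltr0n.
set w' := orth_part ip e w; set x := v a - v b.
pose px := \sum_i ip x (e i) *: e i.
have pxE : ip w px = ip w x - ip w' x.
  rewrite /w' /orth_part (ipBl hip) (ip_sumr hip) (ip_suml hip).
  rewrite opprB addrC subrK; apply: eq_bigr => i _.
  by rewrite (ipZr hip) (ipZl hip) (ipC hip x) mulrC.
have px2 : `|px| ^+ 2 = \sum_i ip x (e i) ^+ 2.
  rewrite -(ip_norm hip px) {1}/px (ip_suml hip); apply: eq_bigr => i _.
  by rewrite (ipZl hip) (ipC hip (e i)) (ip_orth_sum hip he).
have x2 : `|x| <= 2.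
  rewrite (le_trans (ler_normB _ _))//.
  by have := v1 a; have := v1 b; lra.
have Z : `|px| ^+ 2 <= d%:R^-1 + 4 * (k a != k b)%:R.
  rewrite px2; have [kab|kab] := eqVneq (k a) (k b).
    rewrite /= mulr0 addr0.
    apply: (@le_trans _ _ (\sum_(i < m) d%:R^-1 ^+ 2)).
      apply: ler_sum => i _; rewrite (ipC hip) (ipBr hip).
      rewrite -[leLHS]real_normK ?num_real// ler_pXn2r ?nnegrE ?invr_ge0//.
      exact: hk.
    rewrite sumr_const card_ord -[leLHS]mulr_natr expr2 -mulrA ler_piMr ?invr_ge0//.
    by rewrite mulrC ler_pdivrMr// mul1r ler_nat.
  rewrite /= mulr1; apply: le_trans (bessel hip he x) _.
  apply: (@le_trans _ _ 4); last by rewrite lerDr invr_ge0.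
  have -> : 4 = 2 ^+ 2 :> R by ring.
  by rewrite ler_pXn2r ?nnegrE.
have W : ip w px ^+ 2 <= d%:R^-1 + 4 * (k a != k b)%:R.
  apply: le_trans (cauchy_schwarz hip w px) (le_trans _ Z).
  by rewrite ler_piMl ?sqr_ge0// expr_le1.
have -> : ip w x = ip w' (v a) - ip w' (v b) + ip w px.
  by rewrite pxE /x (ipBr hip _ _ w'); ring.
(* [(y1 - y2 + y3) ^ 2 <= 3 * (y1 ^ 2 + y2 ^ 2 + y3 ^ 2)]: the gap is the sum of the squares of
   [y1 + y2], [y1 - y3] and [y2 + y3]. *)
apply: (@le_trans _ _ (3 * (ip w' (v a) ^+ 2 + ip w' (v b) ^+ 2 + ip w px ^+ 2))).
  set y1 := ip w' (v a); set y2 := ip w' (v b); set y3 := ip w px.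
  have := sqr_ge0 (y1 + y2); have := sqr_ge0 (y1 - y3); have := sqr_ge0 (y2 + y3).
  lra.
by rewrite ler_pM2l ?ltr0n// lerD2l.
Qed.

Context {p q : T -> R} (p0 : forall a, 0 <= p a) (q0 : forall a, 0 <= q a).
Context (p1 : \sum_a p a = 1) (q1 : \sum_a q a = 1).
Context (hp : forall w, (forall i, ip w (e i) = 0) ->
      \sum_a p a * ip w (v a) ^+ 2 <= `|w| ^+ 2 / d%:R).

(** Summing [sqr_ip_diff_le] against the coupling leaves the second moments of [p] and [q] along
    [orth_part ip e w]. The first is at most [1 / d] by [hp]; the second differs from it by a sum
    against [q - p], controlled by the Hilbert-Schmidt norm. *)
Lemma coupling_cost_le (rho : T -> T -> R) M w :
  (forall a b, 0 <= rho a b) ->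
  (forall a, p a != 0 -> \sum_b q b * rho a b = 1) ->
  (forall b, q b != 0 -> \sum_a p a * rho a b = 1) ->
  \sum_a \sum_b p a * q b * (rho a b * (k a != k b)%:R) <= M ->
  `|w| <= 1 ->
  \sum_a \sum_b p a * q b * (rho a b * ip w (v a - v b) ^+ 2) <=
    3 * (7 / (2 * d%:R) + d%:R / 2 * quad (fun a => q a - p a) (fun a b => ip (v a) (v b) ^+ 2)
      + 4 * M).
Proof.
move=> rho0 row col mis w1.
have dp : 0 < d%:R :> R by rewrite ltr0n.
pose w' := orth_part ip e w; pose X a := ip w' (v a) ^+ 2.
have X0 a : 0 <= X a by exact: sqr_ge0.
have w'1 : `|w'| <= 1 by apply: le_trans w1; exact: (norm_orth_part_le hip he).
have rowX (f : T -> R) : \sum_a \sum_b p a * q b * (rho a b * f a) = \sum_a p a * f a.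
  apply: eq_bigr => a _; have [pa|pa] := eqVneq (p a) 0.
    by rewrite pa mul0r big1// => b _; rewrite !mul0r.
  rewrite -[RHS]mulr1 -(row a pa) mulr_sumr; apply: eq_bigr => b _; ring.
have colX (f : T -> R) : \sum_a \sum_b p a * q b * (rho a b * f b) = \sum_a q a * f a.
  rewrite exchange_big/=; apply: eq_bigr => b _; have [qb|qb] := eqVneq (q b) 0.
    by rewrite qb mul0r big1// => a _; rewrite mulr0 mul0r.
  rewrite -[RHS]mulr1 -(col b qb) mulr_sumr; apply: eq_bigr => a _; ring.
have pX : \sum_a p a * X a <= d%:R^-1.
  apply: le_trans (hp _ (ip_orth_part hip he w)) _.
  by rewrite ler_piMl ?invr_ge0// expr_le1.
set G := quad _ _.
(* From [Y ^ 2 <= G] and [(d * Y - 1) ^ 2 >= 0]. The square root of [G] is traded for [G] itself,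
   whose mean over samples is under control. *)
have qX : \sum_a (q a - p a) * X a <= d%:R / 2 * G + 1 / (2 * d%:R).
  have := sqr_quad_form_le hip (fun a => q a - p a) v w' w'1.
  rewrite -/G; set Y := \sum_a _ => YG.
  rewrite -(ler_pM2l (mulr_gt0 (ltr0n _ 2) dp)).
  have -> : 2 * d%:R * (d%:R / 2 * G + 1 / (2 * d%:R)) = d%:R ^+ 2 * G + 1.
    by field; rewrite gt_eqF.
  apply: (@le_trans _ _ (d%:R ^+ 2 * Y ^+ 2 + 1)).
    by have := sqr_ge0 (d%:R * Y - 1); lra.
  by rewrite lerD2r ler_pM2l ?exprn_gt0.
apply: (@le_trans _ _ (\sum_a \sum_b (3 * (p a * q b * (rho a b * X a)
   + p a * q b * (rho a b * X b) + (p a * q b * (rho a b * d%:R^-1)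
   + 4 * (p a * q b * (rho a b * (k a != k b)%:R))))))).
  apply: ler_sum => a _; apply: ler_sum => b _.
  have := sqr_ip_diff_le w a b w1; rewrite -/w' -/(X a) -/(X b) => h.
  have pq : 0 <= p a * q b * rho a b by rewrite !mulr_ge0.
  rewrite mulrA; apply: le_trans (ler_wpM2l pq h) _.
  by rewrite le_eqVlt; apply/orP; left; apply/eqP; ring.
under eq_bigr do rewrite -mulr_sumr !big_split/= -mulr_sumr.
rewrite -mulr_sumr ler_pM2l ?ltr0n// !big_split/= -mulr_sumr.
rewrite rowX colX (rowX (fun=> d%:R^-1)) -mulr_suml p1 mul1r.
have -> : \sum_a q a * X a = \sum_a p a * X a + \sum_a (q a - p a) * X a.
  by rewrite -big_split/=; apply: eq_bigr => a _; ring.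
(* Three terms [1 / d]: the second moment of [p], which enters for both marginals, and the grid. The
   remaining half comes from [qX]. *)
have -> : 7 / (2 * d%:R) = 3 * d%:R^-1 + 1 / (2 * d%:R) :> R.
  by field; rewrite gt_eqF.
lra.
Qed.

End Cost.

(* The dimension parameter [d] controls everything: projecting out the [d]
   dominant directions leaves second moments at most [1/d], and the grid of
   mesh [1/d] in these directions has [(2d+1)^d] cells. *)
Lemma discrete_coupling (T : finType) (p : T -> R) (v : T -> H) (d n : nat) :
  (0 < d)%N -> ((2 * d).+1 ^ d * d ^ 2 <= n)%N ->
  (forall a, 0 <= p a) -> \sum_a p a = 1 -> (forall a, `|v a| <= 1) ->
  exists Phi : {ffun 'I_n -> T} -> R, [/\ forall t, 0 <= Phi t,
    \sum_t sample_prob p t * Phi t <= 24 / d%:R &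
    forall t, exists rho : T -> T -> R, [/\ forall a b, 0 <= rho a b,
      forall a, p a != 0 -> \sum_b freq (R := R) t b * rho a b = 1,
      forall b, freq (R := R) t b != 0 -> \sum_a p a * rho a b = 1 &
      forall w, `|w| <= 1 ->
        \sum_a \sum_b p a * freq t b * (rho a b * ip w (v a - v b) ^+ 2) <= Phi t]].
Proof.
move=> d0 dn p0 p1 v1.
have dp : 0 < d%:R :> R by rewrite ltr0n.
have n0 : (0 < n)%N by apply: leq_trans dn; rewrite muln_gt0 !expn_gt0 d0.
have [m [e [md he hp]]] := greedy_subspace hip T p v d d0 p0 p1 v1.
have [k hk] : exists k : T -> {ffun 'I_m -> 'I_(2 * d).+1},
    forall a b, k a = k b -> forall j, `|ip (e j) (v a) - ip (e j) (v b)| <= d%:R^-1.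
  apply: (grid_cells T m (fun j a => ip (e j) (v a)) d d0) => j a.
  apply: le_trans (ip_abs_le hip _ _) _.
  have -> : `|e j| = 1.
    have := he j j; rewrite eqxx (ip_norm hip) => /eqP.
    by rewrite sqrf_eq1 => /orP[/eqP//|/eqP h]; have := normr_ge0 (e j); rewrite h; lra.
  by rewrite mul1r.
pose s (t : {ffun 'I_n -> T}) a := freq t a - p a.
pose G t := quad (s t) (fun a b => ip (v a) (v b) ^+ 2).
pose V t := quad (s t) (fun a b => (k a == k b)%:R).
pose K : R := #|{ffun 'I_m -> 'I_(2 * d).+1}|%:R.
have K0 : 0 < K by rewrite ltr0n card_ffun !card_ord expn_gt0.
(* [V t] is the sum of the squared errors of the cell masses. [M t] dominates the sum of their
   absolute values, by [|y| <= d * K / 2 * y ^ 2 + 1 / (2 * d * K)] on each of the [K] cells. *)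
pose M t := d%:R * K / 2 * V t + 1 / (2 * d%:R).
pose Phi t := 3 * (7 / (2 * d%:R) + d%:R / 2 * G t + 4 * M t).
have VE t : V t = \sum_c (\sum_(a | k a == c) s t a) ^+ 2.
  rewrite /V /quad (partition_big k xpredT)//=; apply: eq_bigr => c _.
  rewrite expr2 mulr_suml; apply: eq_bigr => a /eqP kac.
  rewrite mulr_sumr [RHS]big_mkcond/=; apply: eq_bigr => b _.
  by rewrite kac eq_sym; case: (k b == c); rewrite ?mulr1 ?mulr0.
have G0 t : 0 <= G t by exact: quad_gram_ge0.
have V0 t : 0 <= V t by rewrite VE; apply: sumr_ge0 => c _; exact: sqr_ge0.
have n1 : n%:R != 0 :> R by rewrite pnatr_eq0 -lt0n.
exists Phi; split.
- move=> t; rewrite /Phi /M !(mulr_ge0, addr_ge0)// ?invr_ge0 ?mulr_ge0 ?ler0n// ltW//.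
- have EG : \sum_t sample_prob p t * G t <= n%:R^-1.
    apply: (mean_quad_freq_le p1 n0) => // [a b|a]; first exact: sqr_ge0.
    rewrite (ip_norm hip) -exprM expr_le1//.
  have EV : \sum_t sample_prob p t * V t <= n%:R^-1.
    by apply: (mean_quad_freq_le p1 n0) => // a; rewrite eqxx.
  have -> : \sum_t sample_prob p t * Phi t =
     3 * (11 / (2 * d%:R) + d%:R / 2 * (\sum_t sample_prob p t * G t)
          + 2 * d%:R * K * (\sum_t sample_prob p t * V t)).
    rewrite -[11 / _](sample_mean_cst p1 n0) !mulr_sumr -!big_split/= mulr_sumr.
    apply: eq_bigr => t _; rewrite /Phi /M; field; rewrite gt_eqF//.
  (* The hypothesis on [n] enters here: [K = (2 d + 1) ^ m] is at most [(2 d + 1) ^ d], hence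
     [d ^ 2 * K <= n]. *)
  have Kn : d%:R * K * n%:R^-1 <= d%:R^-1.
    rewrite ler_pdivrMr ?ltr0n// -(ler_pM2l dp) [leRHS]mulrA mulfV ?gt_eqF// mul1r.
    rewrite /K card_ffun !card_ord -!natrM ler_nat; apply: leq_trans dn.
    by rewrite mulnA mulnC mulnn leq_mul2r leq_pexp2l// orbT.
  have dnn : d%:R * n%:R^-1 <= d%:R^-1 :> R.
    apply: le_trans Kn; rewrite ler_wpM2r ?invr_ge0// ler_peMr ?(ltW dp)//.
    by rewrite ler1n -(ltr0n R).
  (* [11 / 2] is [7 / 2] plus the constant part [4 / 2] of [4 * M t]; then
     [3 * (11 / 2 + 1 / 2 + 2) = 24]. *)
  have -> : 24 / d%:R = 3 * (11 / (2 * d%:R) + 1 / 2 * d%:R^-1 + 2 * d%:R^-1) :> R.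
    by field; rewrite gt_eqF.
  rewrite ler_pM2l ?ltr0n// -!addrA lerD2l lerD//.
    apply: le_trans (_ : d%:R / 2 * n%:R^-1 <= _).
      by rewrite ler_wpM2l// divr_ge0 ?ltW.
    by rewrite mulrAC mulrC; lra.
  apply: le_trans (_ : 2 * d%:R * K * n%:R^-1 <= _).
    by rewrite ler_wpM2l// !mulr_ge0 ?ltW.
  by rewrite -!mulrA ler_pM2l ?ltr0n// mulrA.
- move=> t.
  have q0 a : 0 <= freq (R := R) t a.
    by rewrite mulr_ge0 ?invr_ge0//; exact: sumr_ge0.
  have q1 : \sum_a freq (R := R) t a = 1.
    rewrite -mulr_sumr exchange_big/= (eq_bigr (fun=> 1)); last first.
      move=> i _; rewrite (bigD1 (t i))//= eqxx big1 ?addr0// => a.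
      by rewrite eq_sym => /negbTE ->.
    by rewrite sumr_const card_ord mulVf.
  have [rho [rho0 row col mis]] := cell_coupling T _ k p (freq t) p0 q0 p1 q1.
  exists rho; split => // w w1.
  have cost := coupling_cost_le v1 he d0 md hk p0 q0 p1 hp rho (M t) w rho0 row col _ w1.
  rewrite /Phi; apply: cost.
  apply: le_trans mis _; rewrite /M VE mulr_sumr.
  have -> : 1 / (2 * d%:R) = \sum_(c : {ffun 'I_m -> 'I_(2 * d).+1}) 1 / (2 * d%:R * K).
    rewrite sumr_const -/K -[RHS]mulr_natl -/K; field.
    by rewrite !gt_eqF.
  rewrite -big_split/=; apply: ler_sum => c _; set y := \sum_(a | _) _.
  have dK : 0 < d%:R * K by rewrite mulr_gt0.
  rewrite -[2 * d%:R * K]mulrA; set u := d%:R * K in dK *.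
  rewrite -(ler_pM2l (mulr_gt0 (ltr0n _ 2) dK)).
  have -> : 2 * u * (u / 2 * y ^+ 2 + 1 / (2 * u)) = (u * `|y|) ^+ 2 + 1.
    by rewrite exprMn real_normK ?num_real//; field; rewrite gt_eqF.
  have := sqr_ge0 (u * `|y| - 1); lra.
Qed.

End DiscreteCoupling.

(** * Measures and integrals *)

Section MeasureTools.
Context {R : realType}.

(** [msum] is indexed by naturals, so [J] is enumerated through [nth]; an empty [J], which offers no
    default element, gives the zero measure. *)
Lemma finite_mixture {d} {X : measurableType d} (J : finType) (c : J -> R)
    (mu : J -> {measure set X -> \bar R}) : (forall j, 0 <= c j) ->
  exists m : {measure set X -> \bar R},
    (forall A, m A = \sum_(j : J) (c j)%:E * mu j A)%E /\
    forall f : X -> \bar R, measurable_fun setT f -> (forall x, 0 <= f x)%E ->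
      (\int[m]_x f x = \sum_(j : J) (c j)%:E * \int[mu j]_x f x)%E.
Proof.
move=> c0.
pose c' j : {nonneg R} := NngNum (c0 j).
have toJ (F : J -> \bar R) :
    (\sum_(k < #|J|) F (enum_val k) = \sum_(j : J) F j)%E.
  by rewrite (reindex _ (onW_bij _ (enum_val_bij J))).
case: (pickP J) => [j0 _|J0]; last first.
  exists mzero; split => [A|f mf f0]; rewrite big1 => //=.
  - by move=> j; have := J0 j.
  - exact: integral_measure_zero.
  - by move=> j; have := J0 j.
pose g (k : nat) := nth j0 (enum J) k.
have gE (k : 'I_#|J|) : g k = enum_val k by rewrite /g -enum_val_nth.
pose mk (k : nat) : {measure set X -> \bar R} := mscale (c' (g k)) (mu (g k)).
exists (msum mk #|J|); split => [A|f mf f0].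
  rewrite /msum -(toJ (fun j => (c j)%:E * mu j A)%E).
  by apply: eq_bigr => k _; rewrite /mk /mscale/= gE.
rewrite ge0_integral_measure_sum// -(toJ (fun j => (c j)%:E * \int[mu j]_x f x)%E).
by apply: eq_bigr => k _; rewrite /mk ge0_integral_mscale//= gE.
Qed.

Lemma measure_to_probability {d} {X : measurableType d}
    (m : {measure set X -> \bar R}) : m setT = 1%E ->
  exists P : probability X R, forall A, P A = m A.
Proof.
move=> m1.
pose P : probability X R := mnormalize m (@dirac _ X point R).
exists P => A; rewrite /P /= /mnormalize m1 /=.
by rewrite onee_eq0/= invr1 mule1.
Qed.

Lemma law_measure {d d'} {X : measurableType d} {Y : measurableType d'}
    (m : {measure set X -> \bar R}) (f : X -> Y) : measurable_fun setT f ->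
  exists m' : {measure set Y -> \bar R}, forall A, m' A = m (f @^-1` A).
Proof.
move=> mf.
by unshelve eexists;
  [unshelve refine (pushforward m f : {measure set Y -> \bar R}); exact: mf|].
Qed.

(** The integral of a nonnegative function is a supremum over simple functions below it, hence
    monotone without measurability. This allows integrating [S1] of the random sample, whose
    measurability is never established. *)
Lemma ge0_le_integral_nonmeasurable {d} {X : measurableType d}
    (m : {measure set X -> \bar R}) (f g : X -> \bar R) :
  (forall x, 0 <= f x)%E -> (forall x, f x <= g x)%E ->
  (\int[m]_x f x <= \int[m]_x g x)%E.
Proof.
move=> f0 fg; rewrite !ge0_integralTE//; last by move=> x; exact: le_trans (fg x).
apply: le_ereal_sup => _ [h hf <-]; exists h => // x /=.
exact: le_trans (fg x).
Qed.

Lemma integral_law {d d'} {X : measurableType d} {Y : measurableType d'}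
    (P : {measure set X -> \bar R}) (m : {measure set Y -> \bar R}) (f : X -> Y)
    (g : Y -> \bar R) : measurable_fun setT f ->
  (forall A, measurable A -> P (f @^-1` A) = m A) ->
  measurable_fun setT g -> (forall y, 0 <= g y)%E ->
  (\int[P]_x g (f x) = \int[m]_y g y)%E.
Proof.
move=> mf law mg g0.
rewrite -[LHS](ge0_integral_pushforward mf P measurableT mg)//.
by apply: eq_measure_integral => A mA _; exact: law.
Qed.

Lemma integral_finite_valued {d} {X : measurableType d}
    (P : {measure set X -> \bar R}) (T : finType) (i : X -> T) (F : T -> R) :
  (forall t, measurable [set x | i x = t]) -> (forall t, 0 <= F t) ->
  (\int[P]_x (F (i x))%:E = \sum_t (F t)%:E * P [set x | i x = t])%E.
Proof.
move=> mi F0.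
under eq_integral.
  move=> x _.
  have -> : ((F (i x))%:E = \sum_(t : T) (F t)%:E * (\1_[set x | i x = t] x)%:E)%E.
    rewrite (bigD1 (i x))//= indicE mem_set// mule1 big1 ?adde0// => t ti.
    by rewrite indicE memNset ?mule0//= => /esym/eqP; rewrite (negbTE ti).
  over.
rewrite ge0_integral_sum//=.
- apply: eq_bigr => t _; rewrite ge0_integralZl_EFin//; last first.
    exact/measurable_EFinP/measurable_indic.
  by rewrite integral_indic// setIT.
- move=> t; apply: measurable_funeM; exact/measurable_EFinP/measurable_indic.
- by move=> t x _; rewrite mule_ge0// lee_fin.
Qed.

End MeasureTools.

Section Borel.
Context {R : realType} {H : normedModType R}.
Notation bH := (@borelH R H).

Lemma open_measurableH (A : set bH) : @open H A -> measurable A.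
Proof. by move=> oA; apply: sub_sigma_algebra. Qed.

Lemma continuous_measurableH (f : H -> R) : continuous f ->
  measurable_fun (setT : set bH) (f : bH -> R).
Proof.
move=> /continuousP cf.
apply: (measurability _ (RGenOpens.measurableE R)) => //.
move=> _ [_ [a [b ->] <-]]; rewrite setTI.
by apply: open_measurableH; apply: cf; exact: interval_open.
Qed.

Lemma measurable_normB (a : H) : measurable_fun (setT : set bH) (fun x : bH => `|toH x - a|).
Proof.
apply: (continuous_measurableH (fun x => `|x - a|)) => x.
by apply: cvg_norm; apply: cvgB => //; exact: cvg_cst.
Qed.

Lemma measurable_ballH (a : H) r : measurable [set x : bH | `|toH x - a| < r].
Proof.
have := measurable_normB a measurableT _ (measurable_itv `]-oo, r[).
rewrite setTI; congr measurable; apply/seteqP; split => x /=;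
by rewrite in_itv.
Qed.

Lemma measurable_unit_ball : measurable (@unit_ball R H).
Proof.
have := measurable_normB 0 measurableT _ (measurable_itv `]-oo, 1]).
rewrite setTI; congr measurable; apply/seteqP; split => x /=;
by rewrite in_itv/= subr0.
Qed.

Lemma measurable_ip {ip : H -> H -> R} (hip : is_inner_product ip) (w : H) :
  measurable_fun (setT : set bH) (fun x : bH => ip w (toH x)).
Proof.
apply: (continuous_measurableH (ip w)) => x.
apply/cvgrPdist_lt => e e0; near=> y.
rewrite -(ipBr hip); apply: le_lt_trans (ip_abs_le hip _ _) _.
have w0 : 0 < `|w| + 1 by rewrite ltr_wpDl.
apply: (@le_lt_trans _ _ ((`|w| + 1) * `|x - y|)).
  by rewrite ler_wpM2r// lerDl.
rewrite mulrC -ltr_pdivlMr//; near: y.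
by apply: (cvgr_dist_lt (fun t => t)) => //; rewrite divr_gt0.
Unshelve. all: by end_near. Qed.

End Borel.

(** [find] returns [M] when no index below [M] qualifies. In this form the sets where the first
    index is at least [k] are finite intersections, hence measurable. *)
Lemma leq_find_iota (p : pred nat) M k : (k <= M)%N ->
  (k <= find p (iota 0 M))%N <-> forall b, (b < k)%N -> ~~ p b.
Proof.
move=> kM; split=> [kf b bk|h].
  have bf : (b < find p (iota 0 M))%N := leq_trans bk kf.
  have := before_find 0%N bf; rewrite nth_iota ?add0n ?(leq_trans bk)// => ->//.
rewrite leqNgt; apply/negP => fk.
have fM : (find p (iota 0 M) < M)%N := leq_trans fk kM.
have : p (nth 0%N (iota 0 M) (find p (iota 0 M))).
  by apply: nth_find; rewrite has_find size_iota.
by rewrite nth_iota// add0n; apply/negP; exact: h.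
Qed.

(** * Finite discretisation of a law on the unit ball *)

Section Discretization.
Context {R : realType} {H : normedModType R}.
Notation bH := (@borelH R H).

(** Shrinking [x] by [1 - eta / 2] leaves room: a dense point within [eta / 2] of the shrunk vector
    stays in the unit ball and is within [eta] of [x]. *)
Lemma separable_unit_ball_net (eta : R) : @separable_space R H ->
  0 < eta -> eta <= 1 ->
  exists u : nat -> H, (forall b, `|u b| <= 1) /\
    forall x, `|x| <= 1 -> exists b, `|x - u b| < eta.
Proof.
move=> [D [/countable_injP[f finj] clD]] e0 e1.
(* An inverse on [D] of the injection [f] of [D] into [nat]; indices that [f] does not reach get the
   default 0. *)
pose s b := xget 0 [set y | D y /\ f y = b].
exists (fun b => if `|s b| <= 1 then s b else 0); split.
  by move=> b; case: ifP => //; rewrite normr0.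
move=> x x1; pose x' := (1 - eta / 2) *: x.
have xx' : `|x - x'| <= eta / 2.
  rewrite /x' -{1}[x]scale1r -scalerBl opprB addrC subrK normrZ ger0_norm; last by lra.
  by rewrite ler_piMr//; lra.
have nx' : `|x'| <= 1 - eta / 2.
  by rewrite normrZ ger0_norm ?ler_piMr//; lra.
have : closure D x' by rewrite clD.
move=> /(_ (ball x' (eta / 2)) (nbhsx_ballx _ _ _)); case; first by rewrite divr_gt0.
move=> y [Dy]; rewrite -ball_normE/= => x'y.
have y1 : `|y| <= 1.
  have := ler_normB x' (x' - y); rewrite subKr; lra.
exists (f y); have -> : s (f y) = y.
  rewrite /s; have [Dz fz] : [set y0 | D y0 /\ f y0 = f y] (xget 0 [set y0 | D y0 /\ f y0 = f y]).
    by apply: xgetPex; exists y.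
  by apply: finj; rewrite ?inE.
rewrite y1; apply: le_lt_trans (ler_distD x' _ _) _; lra.
Qed.

Lemma measurable_disc_err (T : finType) (i : bH -> T) (v : T -> H) :
  (forall a, measurable [set x | i x = a]) ->
  measurable_fun setT (fun x => `|toH x - v (i x)| ^+ 2).
Proof.
move=> mi.
rewrite (_ : (fun x => _) =
  (fun x => \sum_a \1_[set x | i x = a] x * `|toH x - v a| ^+ 2)); last first.
  apply/funext => x; rewrite (bigD1 (i x))//= indicE mem_set// mul1r.
  rewrite big1 ?addr0// => a ax.
  by rewrite indicE memNset ?mul0r//= => /esym/eqP; rewrite (negbTE ax).
apply: measurable_sum => a; apply: measurable_funM; first exact: measurable_indic.
apply: (measurableT_comp (exprn_measurable 2)); exact: measurable_normB.
Qed.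

(** Cells are indexed by the first of [M] net points within [eta]; the last cell collects the points
    missed by all of them, with representative 0. By continuity of [mu] along increasing sets, its
    mass is at most [eta] for some [M]. *)
Lemma discretization (mu : probability bH R) (eta : R) :
  @separable_space R H -> ball_probabilities mu -> 0 < eta -> eta <= 1 ->
  exists N (i : bH -> 'I_N.+1) (v : 'I_N.+1 -> H),
    [/\ forall a, `|v a| <= 1, forall a, measurable [set x | i x = a] &
      (\int[mu]_x (`|toH x - v (i x)| ^+ 2)%:E <= (2 * eta)%:E)%E].
Proof.
move=> sep mu1 e0 e1; have [u [u1 unet]] := separable_unit_ball_net eta sep e0 e1.
pose p (x : bH) b := `|toH x - u b| < eta.
pose first M x := find (p x) (iota 0 M).
have firstM M x : (first M x <= M)%N.
  by rewrite /first -[X in (_ <= X)%N](size_iota 0 M) find_size.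
pose W M k := [set x | (k <= first M x)%N].
have mW M k : measurable (W M k).
  have [kM|Mk] := leqP k M; last first.
    rewrite (_ : W M k = set0) ?measurable0//.
    apply/seteqP; split => x //=; rewrite /W/= => kx.
    by have := leq_trans Mk (leq_trans kx (firstM M x)); rewrite ltnn.
  rewrite (_ : W M k = \bigcap_(b in `I_k) ~` [set x : bH | `|toH x - u b| < eta]).
    by apply: bigcap_measurableType => b _; apply: measurableC; exact: measurable_ballH.
  apply/seteqP; split => x.
    by move=> /(leq_find_iota _ _ _ kM) h b /h/negP.
  by move=> h; apply/(leq_find_iota _ _ _ kM) => b bk; apply/negP; exact: h.
pose U M := ~` W M M.
have mU M : measurable (U M) by exact: measurableC.
have UE M x : U M x <-> exists b, (b < M)%N /\ p x b.
  split=> [Ux|[b [bM xb]]].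
    apply: contrapT => no; apply: Ux; apply/(leq_find_iota _ _ _ (leqnn M)) => b bM.
    by apply/negP => xb; apply: no; exists b.
  by move=> /(leq_find_iota _ _ _ (leqnn M))/(_ b bM); rewrite xb.
have mUU : measurable (\bigcup_n U n) by exact: bigcup_measurable.
have Uball : unit_ball `<=` \bigcup_n U n.
  move=> x /= /unet[b xb]; exists b.+1 => //; apply/UE; exists b; split => //.
have UU1 : mu (\bigcup_n U n) = 1%E.
  apply/eqP; rewrite eq_le probability_le1//= -[X in (X <= _)%E]mu1.
  by apply: le_measure; rewrite ?inE//; exact: measurable_unit_ball.
have [M muW] : exists M, (mu (W M M) <= eta%:E)%E.
  apply: contrapT => no.
  have : (mu (\bigcup_n U n) <= (1 - eta)%:E)%E.
    have cv : (mu \o U) x @[x --> \oo] --> mu (\bigcup_n U n).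
      apply: (nondecreasing_cvg_mu mU mUU) => n m nm; apply/subsetPset => x /UE[b [bn xb]].
      by apply/UE; exists b; split => //; exact: leq_trans nm.
    apply: (cvge_le _ cv).
    apply: nearW => n /=; rewrite leNgt; apply/negP => h; apply: no; exists n.
    move: h; rewrite /U probability_setC//.
    have : mu (W n n) \is a fin_num by exact: fin_num_measure.
    case: (mu (W n n)) => // r _; rewrite -EFinB lte_fin lee_fin; lra.
  by rewrite UU1 lee_fin; lra.
pose i x : 'I_M.+1 := inord (first M x).
pose v (a : 'I_M.+1) := if (a < M)%N then u a else 0.
have iE x : i x = first M x :> nat by rewrite /i inordK// ltnS.
have mi a : measurable [set x | i x = a].
  rewrite (_ : [set x | _] = W M a `\` W M a.+1); first exact: measurableD.
  apply/seteqP; split => x /=.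
    by move=> <-; rewrite /W/= iE; split => //; rewrite ltnn.
  move=> [ax /negP]; rewrite /W /= -leqNgt => xa.
  by apply/val_inj; rewrite /= iE; apply/eqP; rewrite eqn_leq xa.
exists M, i, v; split => //.
  by move=> a; rewrite /v; case: ifP => _ //; rewrite normr0.
(* Almost surely [|x| <= 1]. The squared error is then at most [eta ^ 2 <= eta] on the cell of a net
   point and at most 1 on the last cell, whose mass is at most [eta]. *)
apply: (@le_trans _ _ (\int[mu]_x (eta + \1_(W M M) x)%:E)%E).
  apply: ae_ge0_le_integral => //.
  - apply/measurable_EFinP; exact: measurable_disc_err.
  - by move=> x _; rewrite lee_fin addr_ge0// ltW.
  - apply/measurable_EFinP; apply: measurable_funD => //; exact: measurable_indic.
  exists (~` unit_ball); split; first exact: measurableC measurable_unit_ball.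
    apply: etrans (probability_setC mu measurable_unit_ball) _.
    by rewrite (mu1 : mu unit_ball = 1%E) subee.
  move=> x /= nh x1; apply: nh => _; rewrite lee_fin /v iE.
  case: ltnP => [xM|Mx].
    have xb : `|toH x - u (first M x)| < eta.
      have : p x (nth 0%N (iota 0 M) (first M x)).
        by apply: nth_find; rewrite has_find size_iota.
      by rewrite nth_iota.
    rewrite ler_wpDr//; apply: (@le_trans _ _ (eta * 1)); last by rewrite mulr1.
    by rewrite expr2 ler_pM// ltW// (lt_le_trans xb).
  rewrite subr0 indicE mem_set// ler_wpDl ?(ltW e0)//.
  by rewrite expr_le1.
under eq_integral do rewrite EFinD.
rewrite ge0_integralD//; last 2 first.
  - by move=> x _; rewrite lee_fin ltW.
  - apply/measurable_EFinP; exact: measurable_indic.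
rewrite integral_cst// [X in (_ * X + _)%E](probability_setT mu) mule1 integral_indic// setIT.
apply: le_trans (leeD2l _ muW) _; rewrite -EFinD lee_fin; lra.
Qed.

End Discretization.

(** * From the discrete coupling to the upper bound *)

Section UpperBound.
Context {R : realType} {H : normedModType R} {ip : H -> H -> R}.
Context (hip : is_inner_product ip).
Notation bH := (@borelH R H).

Lemma S1_ge0 (mu nu : set bH -> \bar R) : (0 <= S1 ip mu nu)%E.
Proof.
apply: le_ereal_inf_tmp => _ [pi _ <-]; apply: le_ereal_sup_tmp.
eexists; last exact: (sqrte_ge0 (\int[pi]_z ((ip 0 (toH z.1 - toH z.2)) ^+ 2)%:E)%E).
by exists 0 => //=; rewrite normr0.
Qed.

Lemma sqr_S1_le (mu nu : set bH -> \bar R) pi (F : R) :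
  couplings mu nu pi -> 0 <= F ->
  (forall w, `|w| <= 1 ->
    (\int[pi]_z ((ip w (toH z.1 - toH z.2)) ^+ 2)%:E <= F%:E)%E) ->
  (S1 ip mu nu * S1 ip mu nu <= F%:E)%E.
Proof.
move=> cpi F0 hw.
have h : (S1 ip mu nu <= (Num.sqrt F)%:E)%E.
  apply: ge_ereal_inf; eexists; first by exists pi.
  apply: ge_ereal_sup => _ [w w1 <-].
  by rewrite -[(Num.sqrt F)%:E]/(sqrte F%:E) lee_sqrt ?lee_fin//; exact: hw.
have -> : F%:E = ((Num.sqrt F)%:E * (Num.sqrt F)%:E)%E.
  by rewrite -EFinM -expr2 sqr_sqrtr.
by apply: lee_pmul => //; exact: S1_ge0.
Qed.

Section Coupling.
Context {mu : probability bH R} {T : finType} {i : bH -> T} {v : T -> H}.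
Context (mi : forall a, measurable [set x | i x = a]).
Context {n : nat} (n0 : (0 < n)%N).

Definition cell_mass a := fine (mu [set x | i x = a]).

Lemma measure_cells A : measurable A ->
  mu A = (\sum_a mu (A `&` [set x | i x = a]))%E.
Proof.
move=> mA.
have := integral_finite_valued (mrestr mu mA) T i (fun=> 1) mi (fun=> ler01).
rewrite integral_cst//= mul1e {1}/mrestr setTI => ->.
by apply: eq_bigr => a _; rewrite mul1e /mrestr setIC.
Qed.

Lemma cell_massE a : mu [set x | i x = a] = (cell_mass a)%:E.
Proof. by rewrite fineK//; exact: fin_num_measure. Qed.

Lemma cell_mass_ge0 a : 0 <= cell_mass a.
Proof. exact: fine_ge0. Qed.

Lemma sum_cell_mass : \sum_a cell_mass a = 1.
Proof.
apply: EFin_inj; rewrite -sumEFin -[RHS](probability_setT mu) (measure_cells _ measurableT).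
by apply: eq_bigr => a _; rewrite setTI cell_massE.
Qed.

(** The coupling is the mixture over [j] and [a] of [mu] restricted to cell [a] times the Dirac mass
    at [y j], with weight [rho a (t j) / n]. [row] gives the first marginal and [col] the second. *)
Lemma exists_cell_coupling (y : 'I_n -> bH) (rho : T -> T -> R)
    (t := [ffun j => i (y j)]) :
  (forall a b, 0 <= rho a b) ->
  (forall a, cell_mass a != 0 -> \sum_b freq t b * rho a b = 1) ->
  (forall b, freq (R := R) t b != 0 -> \sum_a cell_mass a * rho a b = 1) ->
  exists2 pi, couplings mu (empirical y) pi &
    forall a b, pi [set z | i z.1 = a /\ i z.2 = b] =
      (cell_mass a * freq t b * rho a b)%:E.
Proof.
move=> rho0 row col.
have /choice[nu nuE] : forall ja : 'I_n * T, exists m : {measure set (bH * bH) -> \bar R},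
    forall S, m S = mu ([set x | S (x, y ja.1)] `&` [set x | i x = ja.2]).
  move=> [j a].
  have [m mE] := law_measure (mrestr mu (mi a)) (fun x => (x, y j)) (pair2_measurable (y j)).
  by exists m => S; rewrite mE.
pose c (ja : 'I_n * T) := n%:R^-1 * rho ja.2 (t ja.1).
have c0 ja : 0 <= c ja by rewrite mulr_ge0// invr_ge0.
have [m [mE _]] := finite_mixture _ c nu c0.
have {}mE S : m S = (\sum_j \sum_a (n%:R^-1 * rho a (t j))%:E *
    mu ([set x | S (x, y j)] `&` [set x | i x = a]))%E.
  rewrite mE pair_bigA/=; apply: eq_bigr => -[j a] _.
  by rewrite nuE.
have rowT a : cell_mass a != 0 -> \sum_j n%:R^-1 * rho a (t j) = 1.
  move=> pa; rewrite -[RHS](row a pa) /freq.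
  under [RHS]eq_bigr do rewrite -mulrA mulr_suml mulr_sumr.
  rewrite exchange_big/=; apply: eq_bigr => j _.
  rewrite (bigD1 (t j))//= eqxx mul1r big1 ?addr0// => b.
  by rewrite eq_sym => /negbTE ->; rewrite mul0r mulr0.
(* [col] applies because the label of a sample point has positive frequency. *)
have colT j : \sum_a cell_mass a * rho a (t j) = 1.
  apply: col; rewrite mulf_neq0 ?invr_neq0 ?pnatr_eq0 -?lt0n//.
  apply: lt0r_neq0; rewrite (bigD1 j)//= eqxx.
  by rewrite ltr_pwDl//; apply: sumr_ge0.
have fst_marg A : measurable A -> m (A `*` setT) = mu A.
  move=> mA; rewrite mE (measure_cells _ mA) exchange_big/=; apply: eq_bigr => a _.
  have slice j : [set x | (A `*` [set: bH]) (x, y j)] = A.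
    by apply/seteqP; split => [x [//]|x Ax]; split.
  rewrite (eq_bigr (fun j => (n%:R^-1 * rho a (t j))%:E *
      mu (A `&` [set x | i x = a]))%E); last by move=> j _; rewrite slice.
  rewrite -ge0_sume_distrl; last by move=> j _; rewrite lee_fin mulr_ge0// invr_ge0.
  rewrite sumEFin; have [pa|pa] := eqVneq (cell_mass a) 0; last by rewrite rowT// mul1e.
  suff -> : mu (A `&` [set x | i x = a]) = 0 by rewrite mule0.
  apply/eqP; rewrite eq_le measure_ge0 andbT -[leRHS]/(0%:E) -pa -cell_massE.
  by apply: le_measure; rewrite ?inE//; exact: measurableI.
have snd_marg B : measurable B -> m (setT `*` B) = empirical y B.
  move=> mB; rewrite mE /empirical ge0_sume_distrr//.
  apply: eq_bigr => j _; rewrite diracE.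
  have [yB|yB] := boolP (y j \in B).
    rewrite mule1; transitivity (\sum_a (n%:R^-1 * (cell_mass a * rho a (t j)))%:E)%E.
      apply: eq_bigr => a _.
      rewrite (_ : [set x | _] = setT); last first.
        by apply/seteqP; split => x // _; split => //=; rewrite inE in yB.
      by rewrite setTI cell_massE -EFinM; congr _%:E; ring.
    by rewrite sumEFin -mulr_sumr colT mulr1.
  rewrite mule0 big1// => a _.
  rewrite (_ : [set x | _] = set0) ?set0I ?measure0 ?mule0//.
  by apply/seteqP; split => x //= -[_ /= /mem_set]; rewrite (negbTE yB).
have m1 : m setT = 1%E.
  by rewrite -setXTT fst_marg// probability_setT.
have [pi piE] := measure_to_probability m m1.
exists pi.
  by move=> A mA; rewrite !piE; split; [exact: fst_marg|exact: snd_marg].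
move=> a b; rewrite piE mE exchange_big/= (bigD1 a)//= [X in (_ + X)%E]big1 ?adde0; last first.
  move=> a' a'a; rewrite big1// => j _.
  rewrite (_ : _ `&` _ = set0) ?measure0 ?mule0//.
  by apply/seteqP; split => x //= [[xa _] xa']; rewrite -xa xa' eqxx in a'a.
have -> : cell_mass a * freq t b * rho a b =
    \sum_j cell_mass a * n%:R^-1 * rho a b * (t j == b)%:R.
  by rewrite -mulr_sumr /freq; ring.
rewrite -sumEFin; apply: eq_bigr => j _; have -> : t j = i (y j) by rewrite ffunE.
have [<-|yb] := eqVneq (i (y j)) b.
  rewrite (_ : _ `&` _ = [set x | i x = a]).
    by rewrite cell_massE -EFinM; congr _%:E => /=; ring.
  by apply/seteqP; split => x /= => [[]|].
rewrite (_ : _ `&` _ = set0).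
  by rewrite measure0 mule0 mulr0.
by apply/seteqP; split => x //= [[_ /eqP]]; rewrite (negbTE yb).
Qed.

End Coupling.
End UpperBound.

(** * Pathwise and expected cost for a random sample *)

Section ExpectedBound.
Context {R : realType} {H : normedModType R} {ip : H -> H -> R}.
Context (hip : is_inner_product ip).
Notation bH := (@borelH R H).

Section Pathwise.
Context {mu : probability bH R} {T : finType} {i : bH -> T} {v : T -> H}.
Context (mi : forall a, measurable [set x | i x = a]).
Context {n : nat} (n0 : (0 < n)%N).
Let p := cell_mass (mu := mu) (i := i).
Let err (x : bH) : R := `|toH x - v (i x)| ^+ 2.

Lemma sqr_ip_discretize w (x y : bH) : `|w| <= 1 ->
  ip w (toH x - toH y) ^+ 2 <=
    3 * (err x + (err y + ip w (v (i x) - v (i y)) ^+ 2)).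
Proof.
move=> w1.
have e z : ip w (toH z - v (i z)) ^+ 2 <= err z.
  by apply: le_trans (cauchy_schwarz hip _ _) _; rewrite ler_piMl ?sqr_ge0// expr_le1.
have -> : ip w (toH x - toH y) = ip w (toH x - v (i x)) - ip w (toH y - v (i y))
    + ip w (v (i x) - v (i y)) by rewrite !(ipBr hip); ring.
move: (e x) (e y); set a := ip w _; set b := ip w _; set c := ip w _ => ax byy.
have := sqr_ge0 (a + b); have := sqr_ge0 (a - c); have := sqr_ge0 (b + c).
lra.
Qed.

(** Integrating [sqr_ip_discretize] against a coupling independent of [w] gives three terms: the
    error under the marginal [mu], the average error over the sample under the other marginal, and
    the discrete cost on pairs of cells. *)
Lemma sqr_S1_empirical_le alpha (y : 'I_n -> bH) (rho : T -> T -> R) Phi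
    (t := [ffun j => i (y j)]) : 0 <= alpha ->
  (\int[mu]_x (err x)%:E <= alpha%:E)%E ->
  (forall a b, 0 <= rho a b) ->
  (forall a, p a != 0 -> \sum_b freq t b * rho a b = 1) ->
  (forall b, freq (R := R) t b != 0 -> \sum_a p a * rho a b = 1) ->
  0 <= Phi ->
  (forall w, `|w| <= 1 ->
    \sum_a \sum_b p a * freq t b * (rho a b * ip w (v a - v b) ^+ 2) <= Phi) ->
  (S1 ip mu (empirical y) * S1 ip mu (empirical y) <=
    (3 * (alpha + (Phi + n%:R^-1 * \sum_j err (y j))))%:E)%E.
Proof.
move=> al0 hal rho0 row col Phi0 hPhi.
have merr : measurable_fun setT (fun x => (err x)%:E).
  by apply/measurable_EFinP; exact: measurable_disc_err.
have err0 x : (0 <= (err x)%:E)%E by rewrite lee_fin sqr_ge0.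
have [pi cpi piE] := exists_cell_coupling mi n0 y rho rho0 row col.
apply: (sqr_S1_le _ _ _ _ cpi).
  rewrite mulr_ge0// !addr_ge0// mulr_ge0 ?invr_ge0//.
  by apply: sumr_ge0 => j _; exact: sqr_ge0.
move=> w w1.
apply: (@le_trans _ _ (\int[pi]_z (3%:E * ((err z.1)%:E + ((err z.2)%:E
    + (ip w (v (i z.1) - v (i z.2)) ^+ 2)%:E))))%E).
  apply: ge0_le_integral_nonmeasurable => z; first by rewrite lee_fin sqr_ge0.
  by rewrite -!EFinD -EFinM lee_fin; exact: sqr_ip_discretize.
have mii (ab : T * T) : measurable [set z : bH * bH | (i z.1, i z.2) = ab].
  case: ab => a b; rewrite (_ : [set _ | _] = [set x | i x = a] `*` [set x | i x = b]).
    exact: measurableX.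
  by apply/seteqP; split => -[z1 z2] /=; [move=> [-> ->]|move=> [-> ->]].
have mB : measurable_fun setT (fun z : bH * bH => (ip w (v (i z.1) - v (i z.2)) ^+ 2)%:E).
  apply/measurable_EFinP.
  rewrite (_ : (fun z => _) = (fun z : bH * bH => \sum_(ab : T * T)
     (\1_[set z : bH * bH | (i z.1, i z.2) = ab] z) * ip w (v ab.1 - v ab.2) ^+ 2)).
    apply: measurable_sum => ab; apply: measurable_funM => //; exact: measurable_indic.
  apply/funext => z; rewrite (bigD1 (i z.1, i z.2))//= indicE mem_set// mul1r.
  rewrite big1 ?addr0// => ab abz.
  by rewrite indicE memNset ?mul0r//= => /esym/eqP; rewrite (negbTE abz).
have m1 : measurable_fun setT (fun z : bH * bH => (err z.1)%:E).
  exact: (measurableT_comp merr measurable_fst).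
have m2 : measurable_fun setT (fun z : bH * bH => (err z.2)%:E).
  exact: (measurableT_comp merr measurable_snd).
have sq0 z : (0 <= (ip w (v (i (z : bH * bH).1) - v (i z.2)) ^+ 2)%:E)%E.
  by rewrite lee_fin sqr_ge0.
rewrite ge0_integralZl_EFin//; last 2 first.
- by move=> z _; rewrite !adde_ge0.
- by do 2 apply: emeasurable_funD => //.
rewrite EFinM lee_pmul2l//.
rewrite ge0_integralD//; last 2 first.
- by move=> z _; rewrite adde_ge0.
- exact: emeasurable_funD.
rewrite EFinD; apply: leeD.
  apply: le_trans hal; rewrite (integral_law pi mu fst (fun x => (err x)%:E) measurable_fst _ merr err0)//.
  move=> A mA; apply: etrans (cpi A mA).1; congr (pi _).
  by apply/seteqP; split => -[z1 z2]//= [].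
rewrite ge0_integralD// addeC EFinD; apply: leeD.
  have := integral_finite_valued pi _ (fun z : bH * bH => (i z.1, i z.2))
    (fun ab => ip w (v ab.1 - v ab.2) ^+ 2) mii (fun ab => sqr_ge0 _).
  move=> /= ->; apply: le_trans (_ : _ <= (\sum_a \sum_b p a * freq t b *
     (rho a b * ip w (v a - v b) ^+ 2))%:E)%E _; last by rewrite lee_fin; exact: hPhi.
  rewrite pair_bigA/= -sumEFin le_eqVlt; apply/orP; left; apply/eqP.
  apply: eq_bigr => -[a b] _ /=.
  rewrite (_ : [set z | _] = [set z | i z.1 = a /\ i z.2 = b]).
    by rewrite piE -EFinM; congr _%:E; rewrite /p /t; ring.
  by apply/seteqP; split => z /= [-> ->].
have [m [mE mint]] := finite_mixture 'I_n (fun=> n%:R^-1 : R) (fun j => \d_(y j))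
  (fun=> ltac:(by rewrite invr_ge0)).
rewrite (integral_law pi m snd (fun x => (err x)%:E) measurable_snd _ merr err0); last first.
  move=> A mA; rewrite mE -ge0_sume_distrr//; apply: etrans (cpi A mA).2.
  by congr (pi _); apply/seteqP; split => -[z1 z2]//= [].
rewrite mint// mulr_sumr -sumEFin le_eqVlt; apply/orP; left; apply/eqP.
by apply: eq_bigr => j _; rewrite integral_dirac// diracT mul1e -EFinM.
Qed.

End Pathwise.

Section Sampling.
Context {mu : probability bH R} {d : measure_display} {Omega : measurableType d}.
Context {P : probability Omega R} {n : nat} {X : 'I_n -> Omega -> bH}.
Context (iid : iid_with_law P mu X).

Lemma iid_law j A : measurable A -> P (X j @^-1` A) = mu A.
Proof.
move=> mA; have [_ prodE] := iid.
have := prodE (fun l => if l == j then A else setT).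
rewrite (bigD1 j)//= eqxx [X in (_ * X)%E]big1 ?mule1; last first.
  by move=> l /negbTE ->; rewrite probability_setT.
move=> <-; last by move=> l; case: ifP.
congr (P _); apply/seteqP; split => x /=.
  by move=> Ax l _; case: eqP => // ->.
by move=> /(_ j Logic.I); rewrite eqxx.
Qed.

Lemma iid_cells (T : finType) (i : bH -> T) (t : {ffun 'I_n -> T}) :
  (forall a, measurable [set x | i x = a]) ->
  measurable [set x | [ffun j => i (X j x)] = t] /\
  P [set x | [ffun j => i (X j x)] = t] =
    (sample_prob (cell_mass (mu := mu) (i := i)) t)%:E.
Proof.
move=> mi; have [mX prodE] := iid.
have -> : [set x | [ffun j => i (X j x)] = t] =
    \bigcap_(j in [set: 'I_n]) (X j @^-1` [set x | i x = t j]).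
  apply/seteqP; split => x /=; first by move=> <- j _ /=; rewrite ffunE.
  by move=> h; apply/ffunP => j; rewrite ffunE; exact: h.
split.
  apply: fin_bigcap_measurable => // j _.
  by rewrite -[X in measurable X]setTI; exact: mX.
rewrite prodE// /sample_prob -prodEFin; apply: eq_bigr => j _.
by rewrite cell_massE.
Qed.

End Sampling.

(** Discretising at scale [1 / D] costs at most [2 / D] under [mu] and, as each [X j] has law [mu],
    at most [2 / D] on average over the sample; [discrete_coupling] adds [24 / D], and
    [3 * (2 + 24 + 2) = 84]. *)
Lemma mean_sqr_S1_le (mu : probability bH R) d (Omega : measurableType d)
    (P : probability Omega R) n (X : 'I_n -> Omega -> bH) D :
  @separable_space R H -> ball_probabilities mu -> iid_with_law P mu X ->
  (0 < D)%N -> ((2 * D).+1 ^ D * D ^ 2 <= n)%N ->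
  (\int[P]_w (S1 ip mu (empirical (fun i => X i w))
            * S1 ip mu (empirical (fun i => X i w))) <= (84 / D%:R)%:E)%E.
Proof.
move=> sep mu1 iid D0 Dn.
have Dp : 0 < D%:R :> R by rewrite ltr0n.
have n0 : (0 < n)%N by apply: leq_trans Dn; rewrite muln_gt0 !expn_gt0 D0.
have D1 : D%:R^-1 <= 1 :> R by rewrite invf_le1// ler1n.
have [N [i [v [v1 mi hal]]]] := discretization mu D%:R^-1 sep mu1 (ltac:(by rewrite invr_gt0)) D1.
pose p := cell_mass (mu := mu) (i := i).
have [Phi [Phi0 EPhi hPhi]] := discrete_coupling hip _ p v D n D0 Dn
  cell_mass_ge0 (sum_cell_mass mi) v1.
pose al := 2 * D%:R^-1 : R.
have al0 : 0 <= al by rewrite mulr_ge0// invr_ge0.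
pose err (x : bH) : R := `|toH x - v (i x)| ^+ 2.
have merr : measurable_fun setT (fun x => (err x)%:E).
  by apply/measurable_EFinP; exact: measurable_disc_err.
have [mX _] := iid.
pose t w := [ffun j => i (X j w)].
apply: (@le_trans _ _ (\int[P]_w (3%:E * (al%:E + ((Phi (t w))%:E +
   n%:R^-1%:E * \sum_j (err (X j w))%:E))))%E).
  apply: ge0_le_integral_nonmeasurable => w; first by rewrite mule_ge0// S1_ge0.
  have [rho [rho0 row col cost]] := hPhi (t w).
  rewrite sumEFin -EFinM.
  exact: (sqr_S1_empirical_le mi n0 _ _ rho).
have mPhi : measurable_fun setT (fun w => (Phi (t w))%:E).
  apply/measurable_EFinP.
  rewrite (_ : (fun w => _) = (fun w => \sum_s (\1_[set w | t w = s] w) * Phi s)).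
    apply: measurable_sum => s; apply: measurable_funM => //; apply: measurable_indic.
    by have [] := iid_cells iid _ i s mi.
  apply/funext => w; rewrite (bigD1 (t w))//= indicE mem_set// mul1r.
  rewrite big1 ?addr0// => s st.
  by rewrite indicE memNset ?mul0r//= => /esym/eqP; rewrite (negbTE st).
have merrX j : measurable_fun setT (fun w => (err (X j w))%:E).
  exact: (measurableT_comp merr (mX j)).
have err0 x : (0 <= (err x)%:E)%E by rewrite lee_fin sqr_ge0.
have n10 : 0 <= n%:R^-1 :> R by rewrite invr_ge0.
have msum : measurable_fun setT (fun w => \sum_j (err (X j w))%:E)%E.
  by apply: emeasurable_sum => j.
have sum0 w : (0 <= \sum_(j < n) (err (X j w))%:E)%E by apply: sume_ge0.
have Phi0' w : (0 <= (Phi (t w))%:E)%E by rewrite lee_fin.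
have msum' : measurable_fun setT (fun w => n%:R^-1%:E * \sum_j (err (X j w))%:E)%E.
  exact: measurable_funeM.
have sum0' w : (0 <= n%:R^-1%:E * \sum_(j < n) (err (X j w))%:E)%E.
  by rewrite mule_ge0// lee_fin.
have mD : measurable_fun setT (fun w => (Phi (t w))%:E + n%:R^-1%:E * \sum_j (err (X j w))%:E)%E.
  exact: emeasurable_funD.
rewrite ge0_integralZl_EFin//; last 2 first.
- by move=> w _; rewrite !adde_ge0// lee_fin.
- exact: emeasurable_funD.
rewrite ge0_integralD//; last by move=> w _; rewrite adde_ge0.
rewrite integral_cst// [X in (_ * (_ * X + _))%E](probability_setT P) mule1.
rewrite ge0_integralD//.
have -> : (\int[P]_w (Phi (t w))%:E = (\sum_s sample_prob p s * Phi s)%:E)%E.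
  rewrite (integral_finite_valued P _ t Phi) //.
    rewrite -sumEFin; apply: eq_bigr => s _.
    have [_ Pt] := iid_cells iid _ i s mi.
    by rewrite [X in (_ * X)%E]Pt -EFinM mulrC.
  by move=> s; have [] := iid_cells iid _ i s mi.
rewrite ge0_integralZl_EFin// ge0_integral_sum//.
have hsum : (n%:R^-1%:E * \sum_(j < n) \int[P]_w (err (X j w))%:E <= al%:E)%E.
  apply: (@le_trans _ _ (n%:R^-1%:E * \sum_(j < n) al%:E)%E).
    rewrite lee_wpmul2l ?lee_fin//; apply: lee_sum => j _.
    by rewrite (integral_law P mu (X j) (fun x => (err x)%:E))// => A; exact: iid_law iid j A.
  rewrite sumEFin sumr_const card_ord -EFinM lee_fin -[al *+ n]mulr_natl mulrA.
  by rewrite mulVf ?mul1r// pnatr_eq0 -lt0n.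
have -> : 84 / D%:R = 3 * (al + (24 / D%:R + al)) :> R by rewrite /al; ring.
rewrite [leRHS]EFinM lee_pmul2l// EFinD leeD2l// EFinD leeD// lee_fin.
Qed.

End ExpectedBound.

(** * Lower bound *)

(** Weight [e] by 4 to the number of agreements with [eta]: the total over the cube factors as
    [(4 + 1) ^ m], and each [e] in the ball has at least [m - r] agreements. *)
Lemma hamming_ball_card (m r : nat) (eta : {ffun 'I_m -> bool}) :
  (r <= m)%N ->
  (#|[pred e : {ffun 'I_m -> bool} | #|[pred j | e j != eta j]| <= r]| * 4 ^ (m - r)
    <= 5 ^ m)%N.
Proof.
move=> rm.
have -> : (5 ^ m = \sum_(e : {ffun 'I_m -> bool}) \prod_j (if e j == eta j then 4 else 1))%N.
  rewrite -(bigA_distr_bigA (fun j b => if b == eta j then 4 else 1)%N)/= (eq_bigr (fun=> 5%N)) ?prod_nat_const ?card_ord//.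
  by move=> j _; rewrite big_bool; case: (eta j).
rewrite -sum_nat_const.
rewrite [leqRHS](bigID (fun e : {ffun _ -> bool} => #|[pred j | e j != eta j]| <= r)%N)/=.
apply: leq_trans (leq_addr _ _); apply: leq_sum => e er.
rewrite -big_mkcond/= prod_nat_const leq_pexp2l//.
rewrite leq_subLR; apply: leq_trans (leq_add er (leqnn _)).
rewrite -[leqLHS]card_ord -(cardC [pred j | e j != eta j]) leq_add2l.
by apply/subset_leq_card/fintype.subsetP => j; rewrite !inE negbK.
Qed.

(** With [m = 8 l] and [r = l] this bounds a Hamming ball by [32 ^ l] of the [256 ^ l] vertices. It
    rests on [5 ^ 4 = 625 <= 640 = 5 * 2 ^ 7], squared, and [25 <= 32]. *)
Lemma pow5_le l : (5 ^ (8 * l) <= 32 ^ l * 4 ^ (7 * l))%N.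
Proof.
have [->|l0] := posnP l; first by rewrite !muln0.
rewrite !expnM -expnMn leq_exp2r; last exact: l0.
have h : (5 ^ 4 <= 5 * 2 ^ 7)%N by [].
have e : (2 ^ 7 * 2 ^ 7 = 4 ^ 7)%N by rewrite -expnMn.
rewrite (expnD 5 4 4); apply: leq_trans (leq_mul h h) _.
by rewrite mulnACA e; apply: leq_mul.
Qed.

Section LowerBound.
Context {R : realType} {H : normedModType R} {ip : H -> H -> R}.
Context (hip : is_inner_product ip).
Notation bH := (@borelH R H).

(** If [k + 1] free vectors all lay in the span of [k] orthonormal ones, their coefficient matrix
    would have a nonzero left kernel, a linear relation among them. So some orthogonal part is
    nonzero and, normalised, extends the family. *)
Lemma orthonormal_exists m : @infinite_dimensional R H ->
  exists e : 'I_m -> H, orthonormal_family ip e.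
Proof.
move=> infdim; elim: m => [|k [e he]]; first by exists (fun=> 0); case.
have [v vfree] := infdim k.+1.
suff [i vi] : exists i, orth_part ip e (v i) != 0.
  exists (fun j => oapp e (`|orth_part ip e (v i)|^-1 *: orth_part ip e (v i)) (unlift ord_max j)).
  apply: (orthonormal_ext hip he); first exact: unit_scale.
  by move=> j; rewrite (ipZl hip) (ip_orth_part hip he) mulr0.
apply: contrapT => no.
have vE i : v i = \sum_j ip (v i) (e j) *: e j.
  by apply/eqP; rewrite -subr_eq0; apply/negPn/negP => vi; apply: no; exists i.
pose C := \matrix_(i < k.+1, j < k) ip (v i) (e j).
have : kermx C != 0.
  rewrite kermx_eq0 /row_free neq_ltn; apply/orP; left.
  by rewrite ltnS rank_leq_col.
move=> /rowV0Pn[a /sub_kermxP aC] /negP; apply; apply/eqP/rowP => i; rewrite mxE.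
apply: vfree (fun i => a 0 i) _ i.
under eq_bigr do rewrite vE scaler_sumr.
rewrite exchange_big/= big1// => j _.
under eq_bigr do rewrite scalerA.
rewrite -scaler_suml (_ : \sum_i _ = 0) ?scale0r//.
move/rowP/(_ j): aC; rewrite !mxE => aC; rewrite -[RHS]aC.
by apply: eq_bigr => l _; rewrite mxE.
Qed.

(** The sample space is [nat], where every set is measurable: the sample [t] is the point
    [enum_rank t], with mass the product of the [q (t i)]. *)
Lemma exists_iid_finite_support (J : finType) (q : J -> R) (x : J -> bH) n :
  (forall j, 0 <= q j) -> \sum_j q j = 1 ->
  exists (mu : probability bH R) (P : probability nat R) (X : 'I_n -> nat -> bH),
    (forall A, mu A = (\sum_j q j * \1_A (x j))%:E) /\ iid_with_law P mu X.
Proof.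
move=> q0 q1.
have [m [mE _]] := finite_mixture J q (fun j => \d_(x j)) q0.
have {}mE A : m A = (\sum_j q j * \1_A (x j))%:E.
  by rewrite mE -sumEFin; apply: eq_bigr => j _; rewrite /dirac -EFinM.
have mT : m setT = 1%E.
  by rewrite mE (eq_bigr q) ?q1// => j _; rewrite indicT mulr1.
have [mu muE] := measure_to_probability m mT.
pose S := {ffun 'I_n -> J}.
pose c (t : S) := \prod_i q (t i).
have c0 t : 0 <= c t by apply: prodr_ge0.
have [pm [pmE _]] := finite_mixture S c (fun t => \d_(enum_rank t : nat)) c0.
have {}pmE A : pm A = (\sum_t c t * \1_A (enum_rank t : nat))%:E.
  by rewrite pmE -sumEFin; apply: eq_bigr => j _; rewrite /dirac -EFinM.
have pmT : pm setT = 1%E.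
  rewrite pmE (eq_bigr c) => [|t _]; last by rewrite indicT mulr1.
  by rewrite /c -(bigA_distr_bigA (fun _ j => q j))/= big1.
have [P PE] := measure_to_probability pm pmT.
pose X (i : 'I_n) (w : nat) : bH := oapp (fun t : S => x (t i)) point
  [pick t : S | (enum_rank t : nat) == w].
have XE i (t : S) : X i (enum_rank t) = x (t i).
  rewrite /X; case: pickP => [s /eqP/val_inj/enum_rank_inj ->//|/(_ t)].
  by rewrite eqxx.
exists mu, P, X; split; first by move=> A; rewrite muE mE.
split=> [//|A mA].
rewrite PE pmE (eq_bigr (fun i => (\sum_j q j * \1_(A i) (x j))%:E)); last first.
  by move=> i _; rewrite muE mE.
rewrite prodEFin bigA_distr_bigA/=; congr _%:E; apply: eq_bigr => t _.
rewrite big_split/=; congr (_ * _).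
rewrite indicE; have [h|h] := boolP (_ \in _).
  rewrite big1// => i _; rewrite indicE mem_set//.
  by move: h; rewrite inE => /(_ i Logic.I) /=; rewrite XE.
apply/esym/eqP/prodf_eq0; apply: contrapT => no; move: h; rewrite notin_setE; apply => i _ /=.
rewrite XE; apply: contrapT => nA; apply: no; exists i => //.
by rewrite indicE memNset.
Qed.

(** Where the signs disagree, 0 separates the two coordinates, so they differ by at least [s]. A
    zero coordinate of [y] counts as positive. *)
Lemma sum_sqr_ip_sign_le m (e : 'I_m -> H) (x y : H) (eps : {ffun 'I_m -> bool}) (s : R) :
  0 <= s ->
  (forall j, ip (e j) x = (if eps j then s else - s)) ->
  #|[pred j | eps j != (0 <= ip (e j) y)]|%:R * s ^+ 2 <= \sum_j ip (e j) (x - y) ^+ 2.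
Proof.
move=> s0 hx.
rewrite mulr_natl -sumr_const big_mkcond/=; apply: ler_sum => j _.
rewrite inE; case: ifP => [|_]; last exact: sqr_ge0.
rewrite (ipBr hip) hx; case: (eps j); case: (leP 0 (ip (e j) y)) => // yj _.
  by rewrite ler_pXn2r ?nnegrE//; lra.
rewrite -[leRHS]sqrrN ler_pXn2r ?nnegrE//; lra.
Qed.

Lemma measurable_ipB (w : H) :
  measurable_fun setT (fun z : bH * bH => ip w (toH z.1 - toH z.2)).
Proof.
rewrite (_ : (fun z => _) = (fun z : bH * bH => ip w (toH z.1) - ip w (toH z.2))).
  apply: measurable_funB.
    exact: (measurableT_comp (measurable_ip hip w) measurable_fst).
  exact: (measurableT_comp (measurable_ip hip w) measurable_snd).
by apply/funext => z; rewrite (ipBr hip).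
Qed.

(* The trace of the covariance of the displacement is at most [m] times its
   largest directional second moment. *)
Lemma S1_separated_ge m (e : 'I_m -> H) n (y : 'I_n -> bH)
    (mu : probability bH R) (a b : R) :
  (0 < n)%N -> (0 < m)%N ->
  (forall j, `|e j| <= 1) -> 0 <= a ->
  (b%:E <= mu [set x | forall i, (a <= \sum_j ip (e j) (toH x - toH (y i)) ^+ 2)%R])%E ->
  (sqrte (a * b / m%:R)%:E <= S1 ip mu (empirical y))%E.
Proof.
move=> n0 m0 e1 a0 hT; set T := [set x | _] in hT.
have mf i : measurable_fun (setT : set bH)
    (fun x : bH => \sum_j ip (e j) (toH x - toH (y i)) ^+ 2).
  apply: measurable_sum => j.
  rewrite (_ : (fun x => _) = (fun x : bH => (ip (e j) (toH x) - ip (e j) (toH (y i))) ^+ 2)).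
    apply: (measurableT_comp (exprn_measurable 2)).
    apply: measurable_funB => //; exact: measurable_ip.
  by apply/funext => x; rewrite (ipBr hip).
have mT : measurable T.
  rewrite (_ : T = \bigcap_(i in [set: 'I_n]) [set x | a <= \sum_j ip (e j) (toH x - toH (y i)) ^+ 2]).
    apply: fin_bigcap_measurable => // i _.
    have := mf i measurableT _ (measurable_itv `[a, +oo[).
    rewrite setTI; congr measurable; apply/seteqP; split => x /=;
    by rewrite in_itv/= andbT.
  by apply/seteqP; split => x /= h => [i _|i]; exact: h.
(* The set of sample points, written with closed balls of radius 0 so that it is visibly
   measurable. *)
pose Y := \bigcup_(i in [set: 'I_n]) [set x : bH | `|toH x - toH (y i)| <= 0].
have mY : measurable Y.
  apply: fin_bigcup_measurable => // i _.
  have := measurable_normB (toH (y i)) measurableT _ (measurable_itv `]-oo, 0]).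
  rewrite setTI; congr measurable; apply/seteqP; split => x /=;
  by rewrite in_itv.
apply: le_ereal_inf_tmp => _ [pi cpi <-].
set s := ereal_sup _.
(* [Y] carries the second marginal, so intersecting with it loses no mass. *)
have piTY : (b%:E <= pi (T `*` Y))%E.
  have piC : pi (setT `*` ~` Y) = 0.
    rewrite (cpi (~` Y) (measurableC mY)).2 /empirical big1 ?mule0// => i _.
    rewrite diracE memNset// => h; apply: h; exists i => //=.
    by rewrite subrr normr0.
  apply: le_trans hT _; rewrite -(cpi T mT).1.
  have -> : T `*` setT = (T `*` Y) `|` (T `*` ~` Y).
    apply/seteqP; split => -[z1 z2] /=; last by move=> [[]|[]].
    by move=> [Tz _]; have [Yz|nYz] := pselect (Y z2); [left|right].
  apply: le_trans (measureU2 _ _ _) _; try by apply: measurableX => //; exact: measurableC.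
  rewrite -[leRHS]adde0; apply: leeD2l; rewrite -piC; apply: le_measure; rewrite ?inE.
  - by apply: measurableX => //; exact: measurableC.
  - by apply: measurableX => //; exact: measurableC.
  - by move=> -[z1 z2] /= [_ h]; split.
have tr : ((a * b)%:E <= \sum_j \int[pi]_z ((ip (e j) (toH z.1 - toH z.2)) ^+ 2)%:E)%E.
  rewrite -ge0_integral_sum//; last 2 first.
  - move=> j; apply/measurable_EFinP; apply: (measurableT_comp (exprn_measurable 2)).
    exact: measurable_ipB.
  - by move=> j z _; rewrite lee_fin sqr_ge0.
  apply: (@le_trans _ _ (\int[pi]_z (a%:E * (\1_(T `*` Y) z)%:E))%E).
    rewrite ge0_integralZl_EFin//; last first.
      by apply/measurable_EFinP; apply: measurable_indic; exact: measurableX.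
    rewrite integral_indic//; last exact: measurableX.
    by rewrite setIT EFinM lee_wpmul2l.
  apply: ge0_le_integral_nonmeasurable => z; first by rewrite mule_ge0// lee_fin.
  rewrite sumEFin -EFinM lee_fin indicE.
  case: (boolP (z \in _)) => [|_]; last first.
    by rewrite mulr0; apply: sumr_ge0 => j _; exact: sqr_ge0.
  rewrite inE mulr1 => -[Tz [i _ /=]]; rewrite normr_le0 subr_eq0 => /eqP ->.
  exact: Tz.
(* If the supremum were below the bound, each of the [m] directional moments would be below
   [a * b / m] and their sum below [a * b], against [tr]. *)
rewrite leNgt; apply/negP => sle.
have hj j : (\int[pi]_z ((ip (e j) (toH z.1 - toH z.2)) ^+ 2)%:E < (a * b / m%:R)%:E)%E.
  have le_s : (sqrte (\int[pi]_z ((ip (e j) (toH z.1 - toH z.2)) ^+ 2)%:E) <= s)%E.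
    by apply: ereal_sup_ubound; exists (e j) => //=; exact: e1.
  rewrite ltNge; apply/negP => hge; move: sle; apply/negP; rewrite -leNgt.
  apply: le_trans le_s; rewrite lee_sqrt//.
  by apply: integral_ge0 => z _; rewrite lee_fin sqr_ge0.
have : (\sum_(j < m) \int[pi]_z ((ip (e j) (toH z.1 - toH z.2)) ^+ 2)%:E <
    \sum_(j < m) (a * b / m%:R)%:E)%E.
  pose g j := fine (\int[pi]_z ((ip (e j) (toH z.1 - toH z.2)) ^+ 2)%:E)%E.
  have gE j : (\int[pi]_z ((ip (e j) (toH z.1 - toH z.2)) ^+ 2)%:E)%E = (g j)%:E.
    rewrite fineK// ge0_fin_numE; first exact: lt_le_trans (hj j) (leey _).
    by apply: integral_ge0 => z _; rewrite lee_fin sqr_ge0.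
  under eq_bigr do rewrite gE.
  rewrite !sumEFin lte_fin; apply: ltr_sum.
    by apply/hasP; exists (Ordinal m0) => //; rewrite mem_index_enum.
  by move=> j _; rewrite -lte_fin -gE.
rewrite sumEFin sumr_const card_ord -[_ *+ m]mulr_natr divfK ?pnatr_eq0 -?lt0n//.
by rewrite ltNge tr.
Qed.

(** Take the uniform law on the vertices of a cube of dimension [m = 8 l], with coordinates of size
    [m ^ (-1/2)]. Round each sample point to its sign vector: the [n < 2 ^ l] Hamming balls of
    radius [l] about these miss at least half of the vertices. The bound on [S1] holds for every
    sample, not only on average. *)
Lemma sup_rms_S1_ge n l : @infinite_dimensional R H ->
  (0 < n)%N -> (0 < l)%N -> (n < 2 ^ l)%N ->
  ((Num.sqrt (1 / (128 * l%:R)))%:E <= sup_rms_S1 ip n)%E.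
Proof.
move=> infdim n0 l0 nl.
pose m := (8 * l)%N; have m0 : (0 < m)%N by rewrite muln_gt0.
have [e he] := orthonormal_exists m infdim.
have mR : 0 < m%:R :> R by rewrite ltr0n.
pose s : R := Num.sqrt m%:R^-1.
have s0 : 0 <= s by exact: sqrtr_ge0.
have s2 : s ^+ 2 = m%:R^-1 by rewrite sqr_sqrtr// invr_ge0.
pose J := {ffun 'I_m -> bool}.
pose x (eps : J) : H := \sum_j (if eps j then s else - s) *: e j.
have xe eps j : ip (e j) (x eps) = (if eps j then s else - s).
  by rewrite (ipC hip) (ip_orth_sum hip he (fun j => if eps j then s else - s)).
have x1 eps : `|x eps| <= 1.
  rewrite -(@ler_pXn2r _ 2) ?nnegrE// expr1n -(ip_norm hip) {1}/x (ip_suml hip).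
  rewrite (eq_bigr (fun=> m%:R^-1)); last first.
    by move=> j _; rewrite (ipZl hip) xe -s2; case: (eps j); rewrite ?mulrNN expr2.
  by rewrite sumr_const card_ord -(mulr_natr _^-1) mulVf// gt_eqF.
have e1 j : `|e j| <= 1.
  by rewrite -(@ler_pXn2r _ 2) ?nnegrE// expr1n -(ip_norm hip) he eqxx.
pose N : R := #|J|%:R.
have cJ : #|J| = (2 ^ m)%N by rewrite card_ffun card_bool card_ord.
have N0 : 0 < N by rewrite ltr0n cJ expn_gt0.
have q1 : \sum_(j : J) N^-1 = 1 by rewrite sumr_const -(mulr_natr _^-1) mulVf// gt_eqF.
have [mu [P [X [muE iid]]]] := exists_iid_finite_support J (fun=> N^-1) x n
  (fun=> ltac:(by rewrite invr_ge0 ltW)) q1.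
have key (y : 'I_n -> bH) : (sqrte (1 / (128 * l%:R))%:E <= S1 ip mu (empirical y))%E.
  (* [1 / 8] is [l / m], the squared distance forced by [l] sign disagreements, and [1 / 2] bounds
     from below the mass of the vertices outside the balls. *)
  have -> : 1 / (128 * l%:R) = 8^-1 * 2^-1 / m%:R :> R.
    by rewrite /m natrM; field; rewrite pnatr_eq0 -lt0n.
  apply: (S1_separated_ge m e n y mu) => //.
  rewrite muE lee_fin; set T := [set x | _].
  pose ball i := [set eps : J | (#|[pred j | eps j != (0 <= ip (e j) (toH (y i)))%R]| <= l)%N]%SET.
  have goodT eps : eps \notin (\bigcup_i ball i)%SET -> T (x eps).
    move=> epsB i.
    apply: le_trans (sum_sqr_ip_sign_le m e (x eps) (toH (y i)) eps s s0 (xe eps)).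
    have : (l < #|[pred j | eps j != (0 <= ip (e j) (toH (y i)))%R]|)%N.
      rewrite ltnNge; apply/negP => h; move/negP: epsB; apply.
      by apply/bigcupP; exists i => //; rewrite inE.
    rewrite s2 => lH; apply: (@le_trans _ _ (l%:R / m%:R)).
      rewrite /m natrM invfM mulrCA divff ?mulr1// pnatr_eq0 -lt0n//.
    by rewrite ler_wpM2r ?invr_ge0// ler_nat ltnW.
  have cB : (2 * #|(\bigcup_i ball i)%SET| <= 2 ^ m)%N.
    have cb i : (#|ball i| <= 32 ^ l)%N.
      have lm : (l <= m)%N by exact: leq_pmull.
      have := hamming_ball_card m l [ffun j => (0 <= ip (e j) (toH (y i)))%R] lm.
      rewrite (_ : #|_| = #|ball i|)%N; last first.
        apply: eq_card => eps; rewrite !inE; congr (_ <= _)%N; apply: eq_card => j.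
        by rewrite !inE ffunE.
      have -> : (m - l = 7 * l)%N by rewrite /m -[X in (_ - X)%N]mul1n -mulnBl.
      move=> h; rewrite -(@leq_pmul2r (4 ^ (7 * l)))%N ?expn_gt0//.
      apply: leq_trans h _; exact: pow5_le.
    (* [2 * n <= 2 ^ (l + 1) <= 2 ^ (3 l)], and [8 ^ l * 32 ^ l = 2 ^ m]. *)
    apply: (@leq_trans (2 * (n * 32 ^ l))); last first.
      rewrite /m expnM (_ : 2 ^ 8 = 2 ^ 3 * 32)%N// expnMn mulnA leq_mul2r; apply/orP; right.
      rewrite -expnM mulnC muln2; apply: leq_trans (_ : (2 ^ l).*2 <= _)%N.
        by rewrite leq_double ltnW.
      rewrite -mul2n -expnS leq_exp2l//.
      by rewrite -[3%N]/(1 + 2)%N mulnDl mul1n -addn1 leq_add2l muln_gt0.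
    rewrite leq_mul2l/=; apply: (@leq_trans (\sum_(i < n) #|ball i|)).
      apply: (big_ind2 (fun (A : {set J}) k => #|A| <= k)%N) => //; first by rewrite cards0.
      move=> A k A' k' Ak Ak'; apply: leq_trans (leq_card_setU _ _) _.
      exact: leq_add.
    apply: (@leq_trans (\sum_(i < n) 32 ^ l)); first exact: leq_sum.
    by rewrite sum_nat_const card_ord.
  set B := (\bigcup_i ball i)%SET in goodT cB.
  apply: (@le_trans _ _ (\sum_(eps : J) N^-1 * (1 - (eps \in B)%:R))); last first.
    apply: ler_sum => eps _; rewrite ler_pM2l ?invr_gt0//.
    have [_|epsB] := boolP (eps \in B); first by rewrite subrr.
    by rewrite subr0 indicE mem_set//; exact: goodT.
  rewrite -mulr_sumr sumrB sumr_const -/N -natr_sum.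
  have -> : (\sum_(eps : J) (eps \in B) = #|B|)%N by rewrite -sum1_card [RHS]big_mkcond.
  rewrite mulrBr mulVf ?gt_eqF//.
  have : N^-1 * #|B|%:R <= 2^-1.
    rewrite mulrC ler_pdivrMr// mulrC ler_pdivlMr// mulrC -natrM /N cJ ler_nat//.
  lra.
have c0 : 0 <= 1 / (128 * l%:R) :> R by rewrite divr_ge0 ?ler01// mulr_ge0 ?ler0n.
apply: le_ereal_sup_tmp; eexists.
  exists mu, _, _, P, X; split; last by split; [exact: iid|reflexivity].
  rewrite /ball_probabilities /= muE (eq_bigr (fun=> N^-1)) ?q1// => eps _.
  by rewrite indicE mem_set ?mulr1//; exact: x1.
rewrite -[(Num.sqrt _)%:E]/(sqrte (1 / (128 * l%:R))%:E) lee_sqrt; last first.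
  by apply: integral_ge0 => w _; rewrite mule_ge0// S1_ge0.
have -> : (1 / (128 * l%:R))%:E = (\int[P]_w (1 / (128 * l%:R))%:E)%E.
  by rewrite integral_cst// [X in (_ * X)%E](probability_setT P) mule1.
apply: ge0_le_integral_nonmeasurable => w; first by rewrite lee_fin.
have := key (fun i => X i w) => k.
apply: le_trans (lee_pmul (sqrte_ge0 _) (sqrte_ge0 _) k k).
by rewrite /= -EFinM -expr2 sqr_sqrtr.
Qed.

End LowerBound.

(** * Choice of the dimension and conclusion *)

Section Asymptotics.
Context {R : realType}.

(** [expR (- 1 / 8) >= 7 / 8] bounds e by [(8 / 7) ^ 8], which is below 3. *)
Lemma expR1_lt3 : expR 1 < 3 :> R.
Proof.
have h : expR (8^-1) <= 8 / 7 :> R.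
  have := expR_ge1Dx (- 8^-1 : R); rewrite expRN => h.
  have e0 := expR_gt0 (8^-1 : R).
  rewrite -(ler_pM2r (_ : 0 < 7 / 8)) ?divr_gt0//.
  have -> : 8 / 7 * (7 / 8) = 1 :> R by field.
  rewrite -[leRHS](mulfV (lt0r_neq0 e0)) ler_pM2l//; lra.
have -> : 1 = 8%:R * 8^-1 :> R by rewrite mulfV.
rewrite expRM_natl; apply: (@le_lt_trans _ _ ((8 / 7) ^+ 8)); last by lra.
by rewrite ler_pXn2r ?nnegrE ?expR_ge0// divr_ge0.
Qed.

Lemma ln3_gt1 : 1 < ln 3 :> R.
Proof.
rewrite -[X in X < _]expRK ltr_ln ?posrE ?expR_gt0//; exact: expR1_lt3.
Qed.

(* With [D <= ln n / (3 ln (ln n))] one has [(3 D) ^ (3 D) <= n]. *)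
Lemma dimension_choice n : (3 <= n)%N ->
  exists D, [/\ (0 < D)%N, ((2 * D).+1 ^ D * D ^ 2 <= n)%N &
    84 / D%:R <= (504 + 252 / ln (ln 3)) * (ln (ln n%:R) / ln n%:R) :> R].
Proof.
move=> n3; set L := ln n%:R; set l := ln L; set l3 := ln (ln 3).
have ln31 := ln3_gt1.
have l30 : 0 < l3 by apply: ln_gt0.
have L3 : ln 3 <= L by rewrite ler_ln ?posrE ?ltr0n ?ler_nat// (leq_trans _ n3).
have L0 : 0 < L by lra.
have ll3 : l3 <= l by rewrite ler_ln ?posrE//; lra.
have l0 : 0 < l by lra.
have one : (((2 * 1).+1 ^ 1 * 1 ^ 2 <= n)%N) by rewrite expn1 exp1n muln1.
have K0 : 0 <= 252 / l3 by apply: divr_ge0; [rewrite ler0n|exact: ltW].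
have KL : 252 / l3 <= 504 + 252 / l3 by rewrite lerDr ler0n.
have KR : 504 <= 504 + 252 / l3 by rewrite lerDl.
have lL0 : 0 <= l / L by apply: divr_ge0; exact: ltW.
(* If [l < 1] then [L < e < 3], and [D = 1] suffices: [84 = 252 / 3 <= 252 / L], while
   [l / l3 >= 1]. Hence the part [252 / ln (ln 3)] of the constant. *)
have [lt1|ge1] := ltP l 1.
  exists 1%N; split => //; rewrite divr1.
  have Llt : L < 3.
    apply: lt_trans expR1_lt3; rewrite -[X in X < _]lnK ?posrE//.
    by rewrite ltr_expR.
  apply: (@le_trans _ _ (252 / l3 * (l / L))).
    rewrite -[leLHS]mulr1; have -> : 84 = 252 / 3 :> R by field.
    have h1 : 1 <= l3^-1 * l by rewrite mulrC ler_pdivlMr// mul1r.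
    have h2 : 3^-1 <= L^-1 :> R by rewrite lef_pV2 ?posrE// ltW.
    have -> : 252 / l3 * (l / L) = (252 * L^-1) * (l3^-1 * l).
      by field; rewrite !gt_eqF.
    have h3 : 252 / 3 <= 252 * L^-1 by apply: ler_wpM2l h2; rewrite ler0n.
    by apply: (ler_pM _ ler01 h3 h1); apply: divr_ge0; rewrite ler0n.
  exact: ler_wpM2r lL0 _ _ KL.
have [x xE] : exists x, x = L / (3 * l) by exists (L / (3 * l)).
have x0 : 0 < x by rewrite xE divr_gt0// mulr_gt0.
have xlL : l / L = (3 * x)^-1 by rewrite xE; field; rewrite !gt_eqF.
(* Again [D = 1]: [x < 1] means [l / L > 1 / 3], so [504 * (l / L)] exceeds 168. *)
have [xlt|xge] := ltP x 1.
  exists 1%N; split => //; rewrite divr1.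
  apply: (@le_trans _ _ (504 * (l / L))); last exact: ler_wpM2r lL0 _ _ KR.
  rewrite xlL ler_pdivlMr ?mulr_gt0//; lra.
have /andP[Dx xD] := truncn_itv (ltW x0).
set D := Num.truncn x in Dx xD.
have D0 : (0 < D)%N by rewrite /D truncn_gt0.
have DR : 1 <= D%:R :> R by rewrite ler1n.
exists D; split => //.
  have D3 : (0 < 3 * D)%N by rewrite muln_gt0.
  (* [2 D + 1 <= 3 D] and [D + 2 <= 3 D], both because [D >= 1]. *)
  apply: (@leq_trans ((3 * D) ^ (3 * D))%N).
    apply: (@leq_trans ((3 * D) ^ D * (3 * D) ^ 2)%N).
      apply: leq_mul.
        rewrite leq_exp2r// -[3%N]/(1 + 2)%N mulnDl mul1n -addn1 addnC.
        by rewrite leq_add2r.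
      by rewrite leq_exp2r// leq_pmull.
    rewrite -expnD leq_pexp2l// -[3%N]/(1 + 2)%N mulnDl mul1n leq_add2l.
    by rewrite leq_pmulr.
  rewrite -(ler_nat R) natrX natrM.
  have T0 : 0 < 3 * D%:R :> R by lra.
  rewrite -ler_ln ?posrE ?exprn_gt0 ?ltr0n ?(leq_trans _ n3)// lnXn// -[ln (3 * D%:R) *+ _]mulr_natl natrM.
  have TL : 3 * D%:R <= L / l.
    apply: (@le_trans _ _ (3 * x)); first by rewrite ler_pM2l.
    by rewrite le_eqVlt; apply/orP; left; apply/eqP; rewrite xE; field; rewrite gt_eqF.
  (* [3 D <= L / l <= L], because [l >= 1] in this case. *)
  have Tl : ln (3 * D%:R) <= l.
    rewrite ler_ln ?posrE//; apply: le_trans TL _.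
    by rewrite ler_pdivrMr// ler_peMr// ltW.
  apply: (@le_trans _ _ (L / l * l)); last by rewrite divfK// gt_eqF.
  apply: (ler_pM _ _ TL Tl); first exact: ltW.
  by apply: ln_ge0; lra.
(* [x < D + 1 <= 2 D], so [84 / D < 168 / x = 504 * (l / L)]. *)
apply: (@le_trans _ _ (504 * (l / L))); last exact: ler_wpM2r lL0 _ _ KR.
rewrite xlL ler_pdivrMr ?ltr0n// mulrAC ler_pdivlMr ?mulr_gt0//.
by move: xD; rewrite -natr1; lra.
Qed.

(** [l] is one more than the integer part [t] of the binary logarithm of [n]; [n >= 2] gives
    [t >= 1], so [l <= 2 t]. *)
Lemma dyadic_log n : (3 <= n)%N ->
  exists l, [/\ (0 < l)%N, (n < 2 ^ l)%N & ln 2 * l%:R <= 2 * ln n%:R :> R].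
Proof.
move=> n3; exists (trunc_log 2 n).+1; split => //; first exact: trunc_log_ltn.
have n0 : (0 < n)%N by exact: leq_trans n3.
have t1 : (1 <= trunc_log 2 n)%N by apply: trunc_log_max => //; exact: ltnW.
have := trunc_logP (isT : 1 < 2)%N n0; set t := trunc_log 2 n in t1 *.
rewrite -(ler_nat R) natrX => tn.
have h : t%:R * ln 2 <= ln n%:R :> R.
  by rewrite mulr_natl -lnXn ?ltr0n// ler_ln ?posrE ?exprn_gt0 ?ltr0n.
have l2 : 0 < ln 2 :> R by apply: ln_gt0; rewrite ltr1n.
have t1R : 1 <= t%:R :> R by rewrite ler1n.
rewrite -natr1; nra.
Qed.

End Asymptotics.

Theorem theorem1p1 (R : realType) :
  exists c C : R, 0 < c /\ 0 < C /\
  forall (H : completeNormedModType R) (inner : H -> H -> R),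
    is_inner_product inner -> @separable_space R H -> @infinite_dimensional R H ->
    forall n : nat, (3 <= n)%N ->
      ((c / Num.sqrt (ln n%:R))%:E <= sup_rms_S1 inner n)%E /\
      (sup_rms_S1 inner n <=
         (C * Num.sqrt (ln (ln n%:R)) / Num.sqrt (ln n%:R))%:E)%E.
Proof.
have l2 : 0 < ln 2 :> R by apply: ln_gt0; rewrite ltr1n.
have l3 : 0 < ln (ln 3) :> R by apply: ln_gt0; exact: ln3_gt1.
have K0 : 0 < 504 + 252 / ln (ln 3) :> R.
  by apply: addr_gt0; [rewrite ltr0n|apply: divr_gt0; rewrite // ltr0n].
(* [ln 2 / 256] comes from [1 / (128 * l)] with [l <= 2 * ln n / ln 2]; the other radicand is the
   constant of [dimension_choice]. *)
exists (Num.sqrt (ln 2 / 256)), (Num.sqrt (504 + 252 / ln (ln 3))).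
split; first by rewrite sqrtr_gt0; apply: divr_gt0; rewrite // ltr0n.
split; first by rewrite sqrtr_gt0.
move=> H ip hip sep infdim n n3.
have n0 : (0 < n)%N by exact: leq_trans n3.
have L0 : 0 < ln n%:R :> R by apply: ln_gt0; rewrite ltr1n; exact: leq_trans n3.
split.
  have [l [l0 nl hl]] := @dyadic_log R n n3.
  apply: le_trans (sup_rms_S1_ge hip n l infdim n0 l0 nl).
  have c0 : 0 <= ln 2 / 256 :> R by apply: divr_ge0; [exact: ltW|rewrite ler0n].
  rewrite lee_fin -(sqrtrV (ltW L0)) -(sqrtrM _ c0).
  rewrite ler_sqrt ?divr_ge0 ?mulr_ge0 ?ler0n//.
  rewrite ler_pdivrMr// mul1r [leRHS]mulrC ler_pdivlMr ?mulr_gt0 ?ltr0n//; lra.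
have [D [D0 Dn hD]] := @dimension_choice R n n3.
apply: ge_ereal_sup => _ [mu [disp [Om [P [X [mu1 [iid ->]]]]]]].
have h := mean_sqr_S1_le hip mu disp Om P n X D sep mu1 iid D0 Dn.
rewrite -mulrA -sqrtrV ?(ltW L0)// -sqrtrM; last first.
  apply/ln_ge0/ltW/(lt_le_trans ln3_gt1).
  by rewrite ler_ln ?posrE ?ltr0n ?ler_nat.
rewrite -sqrtrM ?(ltW K0)//.
rewrite -[(Num.sqrt _)%:E]/(sqrte (_)%:E) lee_sqrt; last first.
  rewrite lee_fin; apply: le_trans hD; exact: divr_ge0.
by apply: le_trans h _; rewrite lee_fin.
Qed.
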